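(* Let $X$ be a finite dimensional Euclidean space. For each integer $n\ge 1$, let $\mathcal{S}^n$ be the semi-lattice of linear subspaces of $X^n$ generated by the subspaces $$\mathcal{S}_i^n=\{(x_1,\ldots,x_n)\in X^n : x_i=0\}\quad (1\le i\le n),\qquad \mathcal{S}_{ij}^n=\{(x_1,\ldots,x_n)\in X^n : x_i=x_j\}\quad (1\le i\neq j\le n).$$ Let $\Omega_{\mathcal{S}^n}$ be the spectrum (character space) of the commutative $C^*$-algebra $\mathcal{E}_{\mathcal{S}^n}(X^n)$. Then $\Omega_{\mathcal{S}^n}$ is a compactification of $X^n$, and the following hold: 1. $\Omega_{\mathcal{S}^1}$ is the spherical compactification $\overline{X}$ of $X$. 2. The action of the symmetric group $\mathfrak{S}_n$ on $X^n$ by permutation of coordinates extends continuously to $\Omega_{\mathcal{S}^n}$. 3. For every $I=\{i_1<\cdots<i_k\}\subset\{1,\ldots,n\}$ with $k \geq 1$, the projection $p_I^{n,k}\colon X^n\to X^k$, $p_I^{n,k}(x_1,\ldots,x_n)=(x_{i_1},\ldots,x_{i_k})$, extends to a continuous map $\Omega_{\mathcal{S}^n}\to\Omega_{\mathcal{S}^k}$. 4. For all $i\neq j$, the difference map $\delta_{ij}\colon X^n\to X$, $\delta_{ij}(x_1,\ldots,x_n)=x_i-x_j$, extends to a continuous map $\Omega_{\mathcal{S}^n}\to\Omega_{\mathcal{S}^1}=\overline{X}$.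
   Context: For a finite dimensional real vector space $Z$, $\mathbb{S}_Z=\{\hat a : a\in Z,\ a\ne 0\}$ is the set of open half-lines $\hat a=\{ra : r>0\}$, and $\overline{Z}=Z\sqcup\mathbb{S}_Z$ is the spherical (radial) compactification of $Z$: a compact space (homeomorphic to a closed ball) in which $Z$ is open and dense and whose boundary is the sphere $\mathbb{S}_Z$. Thus $C(\overline Z)$ is identified with the algebra of continuous functions on $Z$ having uniform radial limits at infinity. For a finite dimensional Euclidean space $W$ and a family $\mathcal{S}$ of linear subspaces of $W$ with $\{0\}\in\mathcal{S}$, each $f\in C(\overline{W/Y})$ ($Y\in\mathcal{S}$) is viewed as a bounded uniformly continuous function on $W$ by composing with the canonical projection $\pi_Y\colon W\to W/Y$, and $\mathcal{E}_{\mathcal{S}}(W)$ denotes the $C^*$-subalgebra of $C_b^u(W)$ (bounded uniformly continuous functions on $W$) generated by all $C(\overline{W/Y})$, $Y\in\mathcal{S}$. In particular, taking $W=X^n$ and $\mathcal{S}=\mathcal{S}^n$, the algebra $\mathcal{E}_{\mathcal{S}^n}(X^n)$ is the $C^*$-subalgebra of $C_b^u(X^n)$ generated by all $C(\overline{X^n/Y})$, $Y\in\mathcal{S}^n$. A semi-lattice of subspaces is a family of linear subspaces stable under (finite) intersections; the semi-lattice generated by a collection is the smallest one containing it. A compactification of $W$ is a compact Hausdorff space containing $W$ as a dense open subspace; here $W\to\Omega_{\mathcal{S}}$ sends a point to the evaluation character at that point. The assertion that $\Omega_{\mathcal{S}^1}$ is the spherical compactification $\overline X$ means that the identity of $X$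 extends to a homeomorphism $\Omega_{\mathcal{S}^1}\cong\overline X$. *)

(* Defs.v *)
From HB Require Import structures.
From mathcomp Require Import all_boot all_order all_algebra all_fingroup.
From mathcomp Require Import generic_quotient ring_quotient.
From mathcomp Require Import all_classical all_reals all_analysis.
From mathcomp Require Import complex.

Set Implicit Arguments.
Unset Strict Implicit.
Unset Printing Implicit Defensive.

Import Order.TTheory GRing.Theory Num.Theory.
Import numFieldNormedType.Exports.

Local Open Scope classical_set_scope.
Local Open Scope ring_scope.
Local Open Scope complex_scope.
Local Open Scope quotient_scope.

(* R[i] carries the topology of its modulus; real-closed provides none. *)
HB.instance Definition _ (R : realType) :=
  PseudoPointedMetric.copy R[i] (R[i] : numFieldType)^o.

(* TopVect and UniformVect are plain joins: compatibility of the vector and   *)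
(* topological structures is not part of the class. It holds for normed       *)
(* spaces and their powers, the only spaces these classes are used for.       *)
#[short(type="topVectType")]
HB.structure Definition TopVect (R : realType) :=
  {V of Vector R V & Topological V}.

#[short(type="uniformVectType")]
HB.structure Definition UniformVect (R : realType) :=
  {V of Vector R V & Uniform V}.

#[short(type="normedVectType")]
HB.structure Definition NormedVect (R : realType) :=
  {V of Vector R V & NormedModule R V}.

Definition euclidean (R : realType) (X : normedVectType R) : Prop :=
  exists dot : X -> X -> R,
    [/\ forall x y, dot x y = dot y x,
        forall (a : R) x y z, dot (a *: x + y) z = a * dot x z + dot y z &
        forall x, `|x| ^+ 2 = dot x x].

(* X^n with the product uniform structure, i.e. that of its Euclidean norm.   *)
Section Power.
Context (R : realType) (X : normedVectType R) (n : nat).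

Definition power : Type := {ffun 'I_n -> X}.

HB.instance Definition _ := Vector.copy power {ffun 'I_n -> X}.
HB.instance Definition _ := Uniform.copy power
  (initial_topology
     (fun x : power => (x : 'I_n -> X) : prod_topology (fun=> X))).
End Power.


(* The quotient space W / Y with the quotient topology. *)
Section VQuotient.
Context (R : realType) (W : topVectType R) (Y : {vspace W}).

Definition vquot : Type := Quotient.quot Y.

HB.instance Definition _ := GRing.Zmodule.on vquot.

Definition vproj (x : W) : vquot := \pi x.

Definition vquot_open (U : set vquot) : Prop := open (vproj @^-1` U).

Fact vquot_openT : vquot_open setT.
Proof. exact: openT. Qed.

Fact vquot_openI (A B : set vquot) :
  vquot_open A -> vquot_open B -> vquot_open (A `&` B).
Proof. exact: openI. Qed.

Fact vquot_open_bigU (I : Type) (f : I -> set vquot) :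
  (forall i, vquot_open (f i)) -> vquot_open (\bigcup_i f i).
Proof.
move=> fo; rewrite /vquot_open preimage_bigcup.
by apply: bigcup_open => i _; exact: fo.
Qed.

HB.instance Definition _ := isOpenTopological.Build vquot
  vquot_openT vquot_openI vquot_open_bigU.

Lemma vproj_eq (x y : W) : (vproj x = vproj y) <-> (x - y \in Y).
Proof.
by rewrite (Quotient.idealrBE Y); split=> [H|/eqP//]; apply/eqP; exact: H.
Qed.

Lemma vprojK (q : vquot) : vproj (repr (q : Quotient.quot Y)) = q.
Proof. exact: reprK. Qed.

Lemma vprojD (x y : W) : vproj (x + y) = vproj x + vproj y.
Proof. exact: (@Quotient.pi_add W Y x y). Qed.

Definition vquot_scale (a : R) (q : vquot) : vquot := vproj (a *: repr (q : Quotient.quot Y)).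

Lemma vquot_scaleE a (x : W) : vquot_scale a (vproj x) = vproj (a *: x).
Proof.
by apply/vproj_eq; rewrite -scalerBr memvZ//; apply/vproj_eq; exact: vprojK.
Qed.

Fact vquot_scaleA a b (q : vquot) :
  vquot_scale a (vquot_scale b q) = vquot_scale (a * b) q.
Proof. by rewrite -(vprojK q) (vquot_scaleE b) !vquot_scaleE scalerA. Qed.

Fact vquot_scale1 : left_id 1 vquot_scale.
Proof. by move=> q; rewrite -(vprojK q) vquot_scaleE scale1r. Qed.

Fact vquot_scaleDr : right_distributive vquot_scale +%R.
Proof.
move=> a p q; rewrite -(vprojK p) -(vprojK q) -vprojD.
by rewrite (vquot_scaleE _ (_ + _)) scalerDr vprojD -!vquot_scaleE.
Qed.

Fact vquot_scaleDl (q : vquot) : {morph vquot_scale^~ q : a b / a + b}.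
Proof.
by move=> a b; rewrite -(vprojK q) (vquot_scaleE (_ + _)) scalerDl vprojD
  -!vquot_scaleE.
Qed.

HB.instance Definition _ := GRing.Zmodule_isLmodule.Build R vquot
  vquot_scaleA vquot_scale1 vquot_scaleDr vquot_scaleDl.
End VQuotient.

Section SphericalCompactification.
Context (R : realType) (Z : preTopologicalLmodType R).

Definition half_line (a : Z) : set Z := [set r *: a | r in [set r : R | 0 < r]].

Definition sphere_at_infinity : Type :=
  {h : set Z | exists2 a, a != 0 & h = half_line a}.

Definition spherical : Type := (Z + sphere_at_infinity)%type.

HB.instance Definition _ := gen_eqMixin spherical.
HB.instance Definition _ := gen_choiceMixin spherical.

(* U is open iff its trace on Z is open and, for every half-line h in U and   *)
(* every point a of h, there are a neighbourhood V of a and a bound r0 such   *)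
(* that U contains the truncated open cone {r z : z in V, r > r0} and all the *)
(* half-lines through V.                                                      *)
Definition spherical_open (U : set spherical) : Prop :=
  open (inl @^-1` U) /\
  forall h : sphere_at_infinity, U (inr h) -> forall a, sval h a ->
  exists r0 : R, \forall z \near a,
    (forall h' : sphere_at_infinity, sval h' z -> U (inr h')) /\
    (forall r : R, r0 < r -> U (inl (r *: z))).

Fact spherical_openT : spherical_open setT.
Proof. by split=> [|h _ a _]; [exact: openT|exists 0; exact: filterE]. Qed.

Fact spherical_openI (A B : set spherical) :
  spherical_open A -> spherical_open B -> spherical_open (A `&` B).
Proof.
move=> [oA hA] [oB hB]; split=> [|h [Ah Bh] a ha].
  by rewrite preimage_setI; exact: openI.
have [r1 H1] := hA _ Ah _ ha; have [r2 H2] := hB _ Bh _ ha.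
exists (Num.max r1 r2); apply: filterS2 H1 H2 => z [A1 A2] [B1 B2].
split=> [h' h'z|r]; first by split; [exact: A1|exact: B1].
by rewrite gt_max => /andP[r1r r2r]; split; [exact: A2|exact: B2].
Qed.

Fact spherical_open_bigU (I : Type) (f : I -> set spherical) :
  (forall i, spherical_open (f i)) -> spherical_open (\bigcup_i f i).
Proof.
move=> of_; split=> [|h [i _ fih] a ha].
  by rewrite preimage_bigcup; apply: bigcup_open => i _; have [] := of_ i.
have [_ /(_ _ fih _ ha)[r0 H]] := of_ i; exists r0.
by apply: filterS H => z [A1 A2]; split=> [h' /A1|r /A2] ?; exists i.
Qed.

HB.instance Definition _ := isOpenTopological.Build spherical
  spherical_openT spherical_openI spherical_open_bigU.

Definition spherical_in (z : Z) : spherical := inl z.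
End SphericalCompactification.

Section CstarAlgebras.
Context (R : realType) (W : uniformType).

Definition bounded_uniformly_continuous : set (W -> R[i]) :=
  [set f : W -> R[i] | unif_continuous f /\ exists M : R, forall x, `|f x| <= M%:C].

Record is_cstar_subalgebra (B : set (W -> R[i])) : Prop := {
  csub_bu : B `<=` bounded_uniformly_continuous;
  csub0 : B (fun=> 0);
  csubD : forall f g, B f -> B g -> B (fun x => f x + g x);
  csubM : forall f g, B f -> B g -> B (fun x => f x * g x);
  csubZ : forall (c : R[i]) f, B f -> B (fun x => c * f x);
  csub_conj : forall f, B f -> B (fun x => (f x)^*);
  csub_closed : closed (B : set {uniform W -> R[i]}) }.

Definition cstar_generated (G : set (W -> R[i])) : set (W -> R[i]) :=
  smallest [set B | is_cstar_subalgebra B] G.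

(* Non-zero multiplicative C-linear functionals on A.                         *)
(* Elements of the algebra are handled through their values, so that no       *)
(* algebra structure on the subtype A has to be built.                        *)
Record character (A : set (W -> R[i])) := Character {
  char_fun :> A -> R[i];
  charD : forall f g h : A, (forall x, val h x = val f x + val g x) ->
    char_fun h = char_fun f + char_fun g;
  charZ : forall (c : R[i]) (f h : A), (forall x, val h x = c * val f x) ->
    char_fun h = c * char_fun f;
  charM : forall f g h : A, (forall x, val h x = val f x * val g x) ->
    char_fun h = char_fun f * char_fun g;
  char_neq0 : exists f, char_fun f != 0 }.

Definition spectrum (A : set (W -> R[i])) : Type := character A.

(* The weak-* topology, i.e. that of pointwise convergence on A. *)
HB.instance Definition _ A := gen_eqMixin (spectrum A).
HB.instance Definition _ A := gen_choiceMixin (spectrum A).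
HB.instance Definition _ A := Topological.copy (spectrum A)
  (initial_topology
     (fun chi : spectrum A => (chi : A -> R[i]) : prod_topology (fun=> R[i]))).
End CstarAlgebras.

Section SphericalAlgebra.
Context (R : realType) (W : uniformVectType R).
Implicit Types (Y : {vspace W}) (S : set {vspace W}).

(* C(closure of W/Y), pulled back to W along W -> W/Y. *)
Definition radial_functions Y : set (W -> R[i]) :=
  [set f | exists2 g : spherical (vquot Y) -> R[i],
    continuous g & f = fun x => g (spherical_in (vproj Y x))].

Definition spherical_algebra S : set (W -> R[i]) :=
  cstar_generated (\bigcup_(Y in S) radial_functions Y).

Definition spherical_spectrum S : Type := spectrum (spherical_algebra S).

HB.instance Definition _ S := Topological.on (spherical_spectrum S).

Lemma spherical_algebra1 S : S !=set0 -> spherical_algebra S (fun=> 1).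
Proof.
move=> [Y SY]; apply: sub_gen_smallest; exists Y => //.
by exists (fun=> 1) => //; exact: cst_continuous.
Qed.

Section PointEvaluation.
Variables (S : set {vspace W}) (S0 : S !=set0) (x : W).

Let eval (f : spherical_algebra S) : R[i] := val f x.

Fact point_eval_neq0 : exists f, eval f != 0.
Proof.
exists (SigSub (mem_set (spherical_algebra1 S0)) : spherical_algebra S).
by rewrite /eval /= oner_eq0.
Qed.

Definition point_eval : spherical_spectrum S := @Character R W _ eval
  (fun f g h fgh => fgh x) (fun c f h cfh => cfh x) (fun f g h fgh => fgh x)
  point_eval_neq0.
End PointEvaluation.
End SphericalAlgebra.

Section CollisionSubspaces.
Context (R : realType) (X : normedVectType R) (n : nat).
Implicit Types (i j : 'I_n) (x : power X n).

Definition coord0 i : {vspace power X n} :=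
  lker (linfun (fun x : power X n => x i : X)).

Definition coord_eq i j : {vspace power X n} :=
  lker (linfun (fun x : power X n => x i - x j : X)).

Lemma mem_coord0 i x : (x \in coord0 i) = (x i == 0).
Proof.
have lin : linear (fun x : power X n => x i : X).
  by move=> a u v; rewrite !ffunE.
pose l := GRing.isLinear.Build _ _ _ _ (fun x : power X n => x i : X) lin.
pose f : {linear power X n -> X} := HB.pack (fun x : power X n => x i : X) l.
by rewrite memv_ker (lfunE f).
Qed.

Lemma mem_coord_eq i j x : (x \in coord_eq i j) = (x i == x j).
Proof.
have lin : linear (fun x : power X n => x i - x j : X).
  by move=> a u v; rewrite !ffunE scalerBr opprD addrACA.
pose l := GRing.isLinear.Build _ _ _ _ (fun x : power X n => x i - x j : X) lin.
pose f : {linear power X n -> X} :=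
  HB.pack (fun x : power X n => x i - x j : X) l.
by rewrite memv_ker (lfunE f) /= subr_eq0.
Qed.

Definition semilattice (V : vectType R) (S : set {vspace V}) : Prop :=
  forall Y Z, S Y -> S Z -> S (Y :&: Z)%VS.

Definition collision_lattice : set {vspace power X n} :=
  smallest [set S | semilattice S]
    ([set coord0 i | i in setT] `|`
     [set coord_eq ij.1 ij.2 | ij in [set ij : 'I_n * 'I_n | ij.1 != ij.2]]).

Lemma collision_lattice_neq0 : (0 < n)%N -> collision_lattice !=set0.
Proof.
move=> n0; exists (coord0 (Ordinal n0)); apply: sub_gen_smallest.
by left; exists (Ordinal n0).
Qed.

Definition Omega : Type := spherical_spectrum collision_lattice.

HB.instance Definition _ := Topological.on Omega.

Definition Omega_in (n0 : (0 < n)%N) : power X n -> Omega :=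
  point_eval (collision_lattice_neq0 n0).

(* The inverse makes this a left action for the usual (right-to-left)         *)
(* composition; 'S_n composes left to right, so it is a right action of 'S_n. *)
Definition permute (s : 'S_n) (x : power X n) : power X n :=
  [ffun i => x ((s^-1)%g i)].
End CollisionSubspaces.

(* The third clause says that e is a homeomorphism onto an open subspace. *)
Definition is_compactification (T K : topologicalType) (e : T -> K) : Prop :=
  [/\ compact [set: K], hausdorff_space K,
      [/\ injective e, continuous e & forall U, open U -> open (e @` U)] &
      dense (range e)].

Definition is_homeomorphism (T K : topologicalType) (h : T -> K) : Prop :=
  continuous h /\ exists2 k, continuous k & cancel h k /\ cancel k h.

(* Main.v *)
(** Every character of a unital C*-subalgebra A of bounded uniformly continuous
functions on W is the limit along a filter of point evaluations: a nonnegative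
element of A killed by the character is not bounded below by a positive
constant, for otherwise it would be invertible in A.  Hence the evaluations are
dense in the spectrum, which is compact because characters are bounded
pointwise by the sup norm; a bump function in A with small compact support
around each point makes the evaluation map an open embedding.

The radial compactification of a normed space V is identified with its closed
unit ball through z |-> z / (1 + |z|).  This map is Lipschitz on V, so in finite
dimension the functions in C(closure of W/Y) are bounded and uniformly
continuous on W.  Injective linear maps extend to radial compactifications,
so a linear map phi : X^n -> X^m under which the generators of S^m pull back
to members of S^n also pulls back the algebras, and therefore induces a map of
spectra.  For n = 1 every element of the algebra has a radial limit at each
point of closure(X), which gives a continuous bijection from closure(X), a
compact space, onto the spectrum. *)

Require Import Defs.
From HB Require Import structures.
From mathcomp Require Import all_boot all_order all_algebra all_fingroup.
From mathcomp Require Import all_classical all_reals all_analysis.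
From mathcomp Require Import complex lra ring.

Set Implicit Arguments.
Unset Strict Implicit.
Unset Printing Implicit Defensive.

Import Order.TTheory GRing.Theory Num.Theory.
Import numFieldNormedType.Exports.

Local Open Scope classical_set_scope.
Local Open Scope ring_scope.
Local Open Scope complex_scope.

(** * Topology of the complex numbers *)

Lemma ultra_fmap T U (F : set_system T) (f : T -> U) :
  UltraFilter F -> UltraFilter (f @ F).
Proof.
move=> UF; split; first exact: fmap_proper_filter.
move=> G PG FG; apply/seteqP; split=> // P GP.
have [//|FnP] := in_ultra_setVsetC (f @^-1` P) UF.
have [x [Px nPx]] := filter_ex (filterI GP (FG (~` P) FnP)).
by case: nPx.
Qed.

Section ComplexTopology.
Context (R : realType).
Local Notation C := R[i].
Implicit Types (e : C).

(** The topology of [R[i]] is copied from the regular module [C^o], so the norm criterion of normed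
    modules applies to it by conversion. *)
Lemma cvgC_dist T (F : set_system T) {FF : Filter F} (f : T -> C) (l : C) :
  (f @ F --> l) <-> forall e, 0 < e -> \forall x \near F, `|l - f x| < e.
Proof. exact: (@cvgrPdist_lt C C^o). Qed.

Lemma unif_continuousC (W : uniformType) (f : W -> C) :
  unif_continuous f <->
  forall e, 0 < e -> entourage [set xy | `|f xy.1 - f xy.2| < e].
Proof.
rewrite /unif_continuous /=; split=> [H e e0|H E].
  by apply: (H [set xy | `|xy.1 - xy.2| < e]); rewrite -(@entourage_ballE C C^o); exists e.
rewrite -(@entourage_ballE C C^o) => -[e e0 He].
by apply: filterS (H e e0) => xy h; apply: He.
Qed.

(** Every later use of [csub_closed] passes through this sup-norm form, which keeps entourages of
    the function space out of the proofs. *)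
Lemma uniform_closedC (W : uniformType) (B : set (W -> C)) :
  closed (B : set {uniform W -> C}) <->
  forall f, (forall e, 0 < e -> exists2 g, B g & forall x, `|f x - g x| < e) ->
    B f.
Proof.
split=> [cB f H|H].
  rewrite (iffLR (closure_id _) cB) => P /uniform_nbhs [E [+ EP]].
  rewrite -(@entourage_ballE C C^o) => -[e e0 He].
  have [g Bg fg] := H _ e0; exists g; split=> //.
  by apply: EP => /= y _; apply: He; exact: fg.
apply/closure_id/seteqP; split; first exact: subset_closure.
move=> f clf; apply: H => e e0; have /clf[g [Bg fg]] :
    nbhs (f : {uniform W -> C}) [set h | forall y, setT y -> `|f y - h y| < e].
  apply/uniform_nbhs; exists [set xy | `|xy.1 - xy.2| < e]; split=> //.
  by rewrite -(@entourage_ballE C C^o); exists e.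
by exists g => // x; exact: fg.
Qed.

(** The order of [R[i]] compares only elements with equal imaginary parts, so a positive complex
    epsilon is a real one. *)
Lemma posC_real e : 0 < e -> {r : R | 0 < r & e = r%:C}.
Proof.
case: e => a b; rewrite ltcE /= => /andP[/eqP -> a0].
by exists a.
Qed.

Lemma normC_real (r : R) : `|r%:C| = `|r|%:C :> C.
Proof. by rewrite normc_def /= expr0n addr0 sqrtr_sqr. Qed.

Lemma normC_le_ReIm (z : C) : `|z| <= (`|complex.Re z| + `|complex.Im z|)%:C.
Proof.
rewrite {1}[z]complexE (le_trans (ler_normD _ _))//.
rewrite normrM !normC_real normc_def /= expr0n expr1n add0r sqrtr1 mul1r.
by rewrite -rmorphD.
Qed.

Lemma normC_ge_Im (z : C) : `|complex.Im z|%:C <= `|z|.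
Proof.
rewrite normc_def lecR -sqrtr_sqr ler_wsqrtr//.
by rewrite lerDr sqr_ge0.
Qed.

Lemma complex_continuous :
  continuous (fun ab : R * R => (ab.1 +i* ab.2) : C).
Proof.
move=> [a b]; apply/cvgC_dist => e /posC_real[r r0 ->].
have r20 : 0 < r / 2 by rewrite divr_gt0.
have ha : \forall x \near (a, b), `|a - x.1| < r / 2.
  have /cvgrPdist_lt : fst @ (a, b) --> a by exact: cvg_fst.
  exact.
have hb : \forall x \near (a, b), `|b - x.2| < r / 2.
  have /cvgrPdist_lt : snd @ (a, b) --> b by exact: cvg_snd.
  exact.
apply: filterS2 ha hb => -[x y] /= hx hy.
rewrite (le_lt_trans (normC_le_ReIm _))// ltcR /=.
by rewrite (splitr r) ltrD.
Qed.

Lemma compact_boxC (M : R) :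
  compact [set z : C | `|complex.Re z| <= M /\ `|complex.Im z| <= M].
Proof.
have cb : compact ([set` `[(- M), M]] `*` [set` `[(- M), M]] : set (R * R)).
  by apply: compact_setX; exact: segment_compact.
have ci := continuous_compact (continuous_subspaceT complex_continuous) cb.
congr (compact _) : ci; apply/seteqP; split=> [z [[a b] [/= ha hb] <- /=]|].
  by move: ha hb; rewrite !in_itv /= -!ler_norml.
by case=> a b /= [ha hb]; exists (a, b) => //=; rewrite !in_itv /= -!ler_norml.
Qed.

Lemma bounded_ultra_cvgC T (F : set_system T) (f : T -> C) (M : R) :
  UltraFilter F -> (forall x, `|f x| <= M%:C) ->
  exists l : C, f @ F --> l.
Proof.
move=> UF fM; have := @compact_boxC M; rewrite compact_ultra.
move=> /(_ (f @ F) (ultra_fmap _ UF)) []; last by move=> p []; exists p.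
change (\forall x \near F, `|complex.Re (f x)| <= M /\ `|complex.Im (f x)| <= M).
apply: filterE => x; rewrite -!lecR; split; apply: le_trans (fM x).
  exact: normc_ge_Re.
exact: normC_ge_Im.
Qed.

(** Completeness comes from compactness of boxes: the filter eventually lies in a box, hence has a
    cluster point, and the Cauchy condition turns that cluster point into a limit. *)
Lemma cauchy_cvgC T (F : set_system T) (f : T -> C) : ProperFilter F ->
  (forall e, 0 < e -> exists2 P, F P &
     forall x y, P x -> P y -> `|f x - f y| < e) ->
  exists l : C, f @ F --> l.
Proof.
move=> PF H; have [P FP Pf] := H 1 ltr01.
have [x0 Px0] := filter_ex FP.
have [z1 M1 M1E] : {M : R | 0 < M & `|f x0| + 1 = M%:C}.
  by apply: posC_real; rewrite ltr_pwDr.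
have bP x : P x -> `|f x| <= z1%:C.
  move=> Px; rewrite -M1E -lerBlDl (le_trans (lerB_dist _ _))// ltW//.
  exact: Pf.
have := @compact_boxC z1 => /(_ (f @ F) _) [|].
  refine (@filterS _ F _ P _ _ FP) => x Px /=; rewrite -!lecR; split.
    by apply: le_trans (bP _ Px); exact: normc_ge_Re.
  by apply: le_trans (bP _ Px); exact: normC_ge_Im.
move=> l [_ cl]; exists l; apply/cvgC_dist => e e0.
have e20 : 0 < e / 2 by rewrite divr_gt0.
have [Q FQ Qf] := H _ e20.
have Bl : nbhs l [set z : C | `|l - z| < e / 2].
  by have /cvgC_dist/(_ _ e20) : id @ l --> l by exact: cvg_id.
have [z [[y Qy <-] ly]] : (f @` Q) `&` [set z : C | `|l - z| < e / 2] !=set0.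
  by apply: cl => //; refine (@filterS _ F _ Q _ _ FQ) => x Qx; exists x.
apply: filterS FQ => x Qx.
rewrite (splitr e) -(subrK (f y) l) -addrA (le_lt_trans (ler_normD _ _))//.
by rewrite ltrD// Qf.
Qed.

End ComplexTopology.

Section ComplexLimits.
Context (R : realType) (T : Type) (F : set_system T) (FF : Filter F).
Local Notation C := R[i].
Implicit Types (f g : T -> C) (a b c : C).

Lemma cvgC_add f g a b : f @ F --> a -> g @ F --> b ->
  (fun x => f x + g x) @ F --> a + b.
Proof. exact: (@cvgD C C^o). Qed.

Lemma cvgC_mul f g a b : f @ F --> a -> g @ F --> b ->
  (fun x => f x * g x) @ F --> a * b.
Proof. exact: (@cvgM C). Qed.

Lemma cvgC_scale f a c : f @ F --> a -> (fun x => c * f x) @ F --> c * a.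
Proof. by move=> fa; apply: cvgC_mul fa; exact: cvg_cst. Qed.

Lemma cvgC_conj f a : f @ F --> a -> (fun x => (f x)^*) @ F --> a^*.
Proof.
move=> /cvgC_dist fa; apply/cvgC_dist => e /fa.
by apply: filterS => x /=; rewrite -rmorphB normcJ.
Qed.

End ComplexLimits.

(** * C*-algebras of bounded uniformly continuous functions *)

Section BoundedUniformlyContinuous.
Context (R : realType) (W : uniformType).
Local Notation C := R[i].
Local Notation BUC := (@bounded_uniformly_continuous R W).

Lemma bu_cst (c : C) : BUC (fun=> c).
Proof.
split.
  apply/unif_continuousC => e e0.
  by apply: filterE => -[x y] /=; rewrite subrr normr0.
have [M _ ME] : {M : R | 0 < M & `|c| + 1 = M%:C}.
  by apply: posC_real; rewrite ltr_pwDr.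
by exists M => x; rewrite -ME lerDl.
Qed.

Lemma bu_add f g : BUC f -> BUC g -> BUC (fun x => f x + g x).
Proof.
move=> [/unif_continuousC cf [M fM]] [/unif_continuousC cg [N gN]]; split.
  apply/unif_continuousC => e e0.
  have e20 : 0 < e / 2 by rewrite divr_gt0.
  apply: filterS2 (cf _ e20) (cg _ e20) => -[x y] /= fxy gxy.
  by rewrite opprD addrACA (le_lt_trans (ler_normD _ _))// (splitr e) ltrD.
by exists (M + N) => x; rewrite (le_trans (ler_normD _ _))// rmorphD lerD.
Qed.

Lemma bu_mul f g : BUC f -> BUC g -> BUC (fun x => f x * g x).
Proof.
move=> [/unif_continuousC cf [M fM]] [/unif_continuousC cg [N gN]]; split.
  apply/unif_continuousC => e e0.
  (* A common bound of both factors; the summand 1 makes [e / (2 * K)] positive even when both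
     bounds are 0. *)
  pose K : C := `|M|%:C + `|N|%:C + 1.
  have M0 : 0 <= `|M|%:C :> C by rewrite ler0c.
  have N0 : 0 <= `|N|%:C :> C by rewrite ler0c.
  have K0 : 0 < K by rewrite ltr_wpDl// addr_ge0.
  have fK x : `|f x| <= K.
    rewrite (le_trans (fM x))// /K -addrA ler_wpDr ?addr_ge0//.
    by rewrite lecR ler_norm.
  have gK x : `|g x| <= K.
    rewrite (le_trans (gN x))// /K (addrC `|M|%:C) -addrA ler_wpDr ?addr_ge0//.
    by rewrite lecR ler_norm.
  have e20 : 0 < e / (2 * K) by rewrite divr_gt0// mulr_gt0.
  apply: filterS2 (cf _ e20) (cg _ e20) => -[x y] /= fxy gxy.
  have -> : f x * g x - f y * g y = f x * (g x - g y) + (f x - f y) * g y.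
    by ring.
  have eE : e = K * (e / (2 * K)) + e / (2 * K) * K.
    by field; rewrite (gt_eqF K0).
  rewrite (le_lt_trans (ler_normD _ _))// eE !normrM ltr_leD//.
    rewrite (le_lt_trans (ler_wpM2r (normr_ge0 _) (fK x)))//.
    by rewrite ltr_pM2l.
  by rewrite ler_pM// ltW.
exists (M * N) => x; rewrite normrM rmorphM ler_pM//.
Qed.

Lemma bu_conj f : BUC f -> BUC (fun x => (f x)^*).
Proof.
move=> [/unif_continuousC cf [M fM]]; split.
  apply/unif_continuousC => e e0; apply: filterS (cf _ e0) => -[x y] /=.
  by rewrite -rmorphB normcJ.
by exists M => x; rewrite normcJ.
Qed.

Lemma bu_closed : closed (BUC : set {uniform W -> C}).
Proof.
apply/uniform_closedC => f Hf; split.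
  apply/unif_continuousC => e e0.
  have e30 : 0 < e / 3 by rewrite divr_gt0.
  have [g [/unif_continuousC cg _] fg] := Hf _ e30.
  apply: filterS (cg _ e30) => -[x y] /= gxy.
  have -> : f x - f y = (f x - g x) + (g x - g y) - (f y - g y) by ring.
  have -> : e = e / 3 + e / 3 + e / 3 by field.
  rewrite (le_lt_trans (ler_normB _ _))// ltrD// (le_lt_trans (ler_normD _ _))//.
  by rewrite ltrD.
have [g [_ [M gM]] fg] := Hf 1 ltr01.
exists (1 + M) => x; rewrite -(subrK (g x) (f x)) (le_trans (ler_normD _ _))//.
by rewrite rmorphD/= lerD// ltW.
Qed.

Lemma bu_cstar_subalgebra : is_cstar_subalgebra BUC.
Proof.
split=> //; [exact: bu_cst|exact: bu_add|exact: bu_mul| |exact: bu_conj|].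
  by move=> c f; apply: bu_mul; exact: bu_cst.
exact: bu_closed.
Qed.

Lemma bu_continuous f : BUC f -> continuous f.
Proof.
move=> [/unif_continuousC cf _] x; apply/cvgC_dist => e /cf fe.
apply: filterS (nbhs_entourage x fe) => y /=.
by rewrite /xsection /= in_setE.
Qed.

End BoundedUniformlyContinuous.

Section CstarGenerated.
Context (R : realType) (W : uniformType).
Local Notation C := R[i].

(** The hypothesis puts the algebra of all bounded uniformly continuous functions among those being
    intersected, which gives the first axiom; the others pass to intersections. *)
Lemma cstar_generated_cstar (G : set (W -> C)) :
  G `<=` @bounded_uniformly_continuous R W ->
  is_cstar_subalgebra (cstar_generated G).
Proof.
move=> GB; split.
- by move=> f; apply; split=> //; exact: bu_cstar_subalgebra.
- by move=> B [HB _]; exact: csub0.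
- by move=> f g Af Ag B BG; exact: (csubD BG.1 (Af _ BG) (Ag _ BG)).
- by move=> f g Af Ag B BG; exact: (csubM BG.1 (Af _ BG) (Ag _ BG)).
- by move=> c f Af B BG; exact: (csubZ BG.1 c (Af _ BG)).
- by move=> f Af B BG; exact: (csub_conj BG.1 (Af _ BG)).
apply/uniform_closedC => f Hf B BG; apply: (iffLR (uniform_closedC B)) => [|e e0].
  exact: csub_closed BG.1.
by have [g Ag fg] := Hf e e0; exists g => //; exact: Ag.
Qed.

Lemma cstar_sub (A : set (W -> C)) f g : is_cstar_subalgebra A ->
  A f -> A g -> A (fun x => f x - g x).
Proof.
move=> HA Af Ag; have := csubD HA Af (csubZ HA (-1) Ag).
by congr (A _); apply/funext => x; rewrite mulN1r.
Qed.

End CstarGenerated.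

(** * Characters and the spectrum *)

Section Characters.
Context (R : realType) (W : uniformType) (A : set (W -> R[i])).
Hypotheses (HA : is_cstar_subalgebra A) (A1 : A (fun=> 1)).
Local Notation C := R[i].
Implicit Types (chi : character A) (f g h : W -> C).

Definition elt f (Af : A f) : A := SigSub (mem_set Af).

Lemma eltP (a : A) : A (val a).
Proof. exact: set_mem (valP a). Qed.

Lemma cstar_cst (c : C) : A (fun=> c).
Proof. by have := csubZ HA c A1; congr (A _); apply/funext => x; rewrite mulr1. Qed.

Lemma cstar_bounded f : A f -> exists M : R, forall x, `|f x| <= M%:C.
Proof. by case/(csub_bu HA). Qed.

(* The inverse is M^-1 times the geometric series of 1 - g / M, where M is a
   bound of g. *)
Lemma cstar_inv g (e : C) : A g -> 0 < e -> (forall x, e <= g x) ->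
  A (fun x => (g x)^-1).
Proof.
move=> Ag e0 eg; have [M0 gM0] := cstar_bounded Ag.
have [M MM0 M1] : exists2 M : R, M0 <= M & 1 <= M.
  by exists (Num.max M0 1); rewrite le_max lexx ?orbT.
have g0 x : 0 < g x by exact: lt_le_trans (eg x).
have gM x : g x <= M%:C.
  rewrite (le_trans _ (_ : M0%:C <= _)) ?lecR//.
  by rewrite -(gtr0_norm (g0 x)).
have M0' : 0 < M by exact: lt_le_trans M1.
have MC0 : 0 < M%:C :> C by rewrite ltcR.
have [r r0 eE] := posC_real e0.
(* On an inhabited W one has r <= M; the maximum with 0 keeps q nonnegative in every case. *)
pose q := Num.max 0 (1 - r / M).
have q0 : 0 <= q by rewrite le_max lexx.
have q1 : q < 1 by rewrite gt_max ltr01 gtrBl divr_gt0.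
pose u x := 1 - g x / M%:C.
have u0 x : 0 <= u x by rewrite subr_ge0 ler_pdivrMr// mul1r.
have uq x : u x <= q%:C.
  rewrite (le_trans _ (_ : (1 - r / M)%:C <= _))//; last first.
    by rewrite lecR le_max lexx orbT.
  rewrite rmorphB rmorph1 lerD2l lerN2 rmorphM/= fmorphV -eE.
  by rewrite ler_pM2r ?invr_gt0.
(* The partial sums satisfy s_(n+1) = u s_n + 1/M, and the exact error of s_n is u^n / g. *)
have partial n : exists2 s, A s & forall x, (g x)^-1 - s x = u x ^+ n / g x.
  elim: n => [|n [s As sE]].
    by exists (fun=> 0) => [|x]; [exact: csub0|rewrite subr0 expr0 mul1r].
  exists (fun x => u x * s x + M%:C^-1).
    apply: (csubD HA) (cstar_cst _); apply: (csubM HA) As.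
    apply: (cstar_sub HA) A1 _.
    have := csubZ HA (M%:C^-1) Ag; congr (A _); apply/funext => x.
    by rewrite mulrC.
  move=> x; rewrite exprS -mulrA -sE mulrBr opprD addrA addrAC; congr (_ - _).
  rewrite /u; field.
  by rewrite (gt_eqF (g0 x)) (gt_eqF MC0).
apply: (iffLR (uniform_closedC A) (csub_closed HA)) => d d0.
(* With t = d e, the bound q^N < t makes the error at most q^N / e < d. *)
have [t t0 tE] := posC_real (mulr_gt0 d0 e0).
have : (fun n => q ^+ n) @ \oo --> 0 by apply: cvg_expr; rewrite ger0_norm.
move=> /cvgrPdist_lt/(_ _ t0)[N _ /(_ N (leqnn N))] /=.
rewrite sub0r normrN ger0_norm ?exprn_ge0// => qt.
have [s As sE] := partial N; exists s => // x.
rewrite sE ger0_norm ?divr_ge0 ?exprn_ge0 ?(ltW (g0 x))//.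
rewrite ltr_pdivrMr// (le_lt_trans (_ : _ <= (q ^+ N)%:C))//.
  by rewrite rmorphXn/= lerXn2r ?nnegrE ?ler0c.
rewrite (lt_le_trans (_ : _ < t%:C)) ?ltcR// -tE.
by rewrite ler_pM2l.
Qed.

Lemma char_one chi : chi (elt A1) = 1.
Proof.
have [f f0] := char_neq0 chi.
have ff : chi f = chi f * chi (elt A1) by apply: Defs.charM => x /=; rewrite mulr1.
by apply: (mulfI f0); rewrite mulr1 -ff.
Qed.

Lemma char_cst chi (c : C) : chi (elt (cstar_cst c)) = c.
Proof.
by rewrite (@charZ _ _ _ chi c (elt A1)) ?char_one ?mulr1// => x /=; rewrite mulr1.
Qed.

Lemma char_ext chi chi' : (forall f : A, chi f = chi' f) -> chi = chi'.
Proof.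
case: chi chi' => [u a1 a2 a3 a4] [v b1 b2 b3 b4] /= /funext uv.
by case: v / uv b1 b2 b3 b4 => *; congr Character; exact: Prop_irrelevance.
Qed.

(** Through the evaluation map, this is the trace on W of the neighbourhoods of [chi] in the
    spectrum. The threshold 1 is as good as any other, since [a] may be rescaled. *)
Definition char_filter chi : set_system W :=
  [set P | exists a : A, [/\ forall x, 0 <= val a x, chi a = 0 &
                           [set x | val a x < 1] `<=` P]].

Lemma char_filter_mem chi (a : A) (P : set W) : (forall x, 0 <= val a x) ->
  chi a = 0 -> [set x | val a x < 1] `<=` P -> char_filter chi P.
Proof. by move=> *; exists a. Qed.

Global Instance char_filter_proper chi : ProperFilter (char_filter chi).
Proof.
split; last split.
- move=> [a [a0 chia /(_ _ _)/= sa]].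
  (* An empty sublevel set means 1 <= a everywhere, so [a] is invertible in A, against
     [chi a = 0]. *)
  have a1 x : 1 <= val a x.
    by rewrite real_leNgt ?real1 ?ger0_real//; apply/negP => /sa.
  have Ai := cstar_inv (eltP a) ltr01 a1.
  have : chi (elt A1) = chi (elt Ai) * chi a.
    apply: Defs.charM => x /=; rewrite mulVf//.
    by apply: lt0r_neq0; apply: lt_le_trans (a1 x).
  by rewrite chia mulr0 char_one => /eqP; rewrite oner_eq0.
- exists (elt (csub0 HA)); split=> //.
  rewrite (@charZ _ _ _ chi 0 (elt A1)) ?mul0r// => x /=.
  by rewrite mul0r.
- move=> P Q [a [a0 chia aP]] [b [b0 chib bQ]].
  (* By nonnegativity, a + b dominates both [a] and [b], so its sublevel set lies in both of
     theirs. *)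
  exists (elt (csubD HA (eltP a) (eltP b))); split=> [x| |x /= ab].
  + by rewrite addr_ge0.
  + by rewrite (@charD _ _ _ chi a b)// chia chib addr0.
  + split; [apply: aP|apply: bQ] => /=; apply: le_lt_trans ab.
      by rewrite lerDl; exact: b0.
    by rewrite lerDr; exact: a0.
- by move=> P Q PQ [a [a0 chia aP]]; exists a; split=> // x /aP /PQ.
Qed.

(** The function |a - chi a|^2 / e^2 belongs to A, is nonnegative and is killed by [chi]; its
    sublevel set at 1 is exactly where [a] is within e of [chi a]. *)
Lemma cvg_char chi (a : A) : val a @ char_filter chi --> chi a.
Proof.
apply/cvgC_dist => e e0.
have Ad := cstar_sub HA (eltP a) (cstar_cst (chi a)).
have chid : chi (elt Ad) = 0.
  have -> : 0 = chi a + -1 * chi (elt (cstar_cst (chi a))).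
    by rewrite char_cst mulN1r subrr.
  rewrite -(@charZ _ _ _ chi (-1) _ (elt (csubZ HA (-1) (cstar_cst (chi a)))))//.
  by apply: charD => x /=; rewrite mulN1r.
have Ap := csubM HA Ad (csub_conj HA Ad).
apply: (@char_filter_mem _ (elt (csubZ HA (e ^- 2) Ap))) => [x||x] /=.
- by rewrite mulr_ge0 ?mulcJ_ge0// invr_ge0 exprn_ge0// ltW.
- rewrite (@charZ _ _ _ chi (e ^- 2) (elt Ap))//.
  rewrite (@Defs.charM _ _ _ chi (elt Ad) (elt (csub_conj HA Ad)) (elt Ap))//.
  by rewrite chid mul0r mulr0.
rewrite -sqr_normc mulrC ltr_pdivrMr ?exprn_gt0// mul1r distrC.
by rewrite ltr_pXn2r ?nnegrE// ltW.
Qed.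

(** [chi a] is a limit of values of [a], so it inherits any bound on them. *)
Lemma char_bounded chi (a : A) (M : R) : (forall x, `|val a x| <= M%:C) ->
  `|chi a| <= M%:C.
Proof.
move=> aM; rewrite real_leNgt ?normr_real//; last by apply/complex_realP; exists M.
apply/negP => Ma.
have /cvgC_dist/(_ (`|chi a| - M%:C)) := @cvg_char chi a.
rewrite subr_gt0 => /(_ Ma) /filter_ex[x].
rewrite ltrBrDr; apply/negP; rewrite -real_leNgt ?realD ?normr_real//; last first.
  by apply/complex_realP; exists M.
rewrite -{1}(subrK (val a x) (chi a)) (le_trans (ler_normD _ _))// lerD2l.
exact: aM.
Qed.

End Characters.

Lemma cvg_initial (S : choiceType) (T : topologicalType) (f : S -> T)
    (F : set_system S) (s : S) : Filter F ->
  f @ F --> f s -> F --> (s : initial_topology f).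
Proof.
move=> FF fF P [_ [[B oB <-] Bs] BP].
by apply: filterS BP _; apply: fF; exact: open_nbhs_nbhs.
Qed.

Section Spectrum.
Context (R : realType) (W : uniformType) (A : set (W -> R[i])).
Hypotheses (HA : is_cstar_subalgebra A) (A1 : A (fun=> 1)).
Local Notation C := R[i].
Implicit Types (chi : spectrum A) (f g h : W -> C).

Lemma spectrum_cvg (F : set_system (spectrum A)) chi : Filter F ->
  (forall a : A, (fun psi : spectrum A => psi a) @ F --> chi a) -> F --> chi.
Proof.
move=> FF Fa; apply: cvg_initial; apply/cvg_sup => a.
apply: (@cvg_initial _ _ (@^~ a)); exact: Fa.
Qed.

Lemma char_eval_continuous (a : A) : continuous (fun chi : spectrum A => chi a).
Proof.
move=> chi.
have ci := @initial_continuous (spectrum A) (prod_topology (fun _ : A => C))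
  (fun chi => chi : A -> C).
exact: (continuous_comp (ci chi) (@proj_continuous A (fun=> C) a _)).
Qed.

Lemma spectrum_continuous (T : topologicalType) (u : T -> spectrum A) :
  (forall a : A, continuous (fun t => u t a)) -> continuous u.
Proof. by move=> cu t; apply: spectrum_cvg => a; exact: cu. Qed.

Lemma eqC_dist (x y : C) : (forall e, 0 < e -> `|x - y| < e) -> x = y.
Proof.
move=> xy; apply/eqP; rewrite -subr_eq0 -normr_eq0.
have [//|n0] := eqVneq `|x - y| 0.
by have := xy `|x - y|; rewrite ltxx lt_def n0 normr_ge0 => /(_ isT).
Qed.

Lemma spectrum_hausdorff : hausdorff_space (spectrum A).
Proof.
move=> p q pq; apply: char_ext => a; apply: eqC_dist => e e0.
have e20 : 0 < e / 2 by rewrite divr_gt0.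
have /cvgC_dist/(_ _ e20) np := @char_eval_continuous a p.
have /cvgC_dist/(_ _ e20) nq := @char_eval_continuous a q.
have [x [/= px qx]] := pq _ _ np nq.
rewrite -(subrK (x a) (p a)) -addrA (splitr e) (le_lt_trans (ler_normD _ _))//.
by rewrite ltrD// distrC.
Qed.

Lemma cvgC_unique T (F : set_system T) (u : T -> C) (x y : C) : ProperFilter F ->
  u @ F --> x -> u @ F --> y -> x = y.
Proof.
move=> PF /cvgC_dist ux /cvgC_dist uy; apply: eqC_dist => e e0.
have e20 : 0 < e / 2 by rewrite divr_gt0.
have [t [/= xt yt]] := filter_ex (filterI (ux _ e20) (uy _ e20)).
rewrite -(subrK (u t) x) -addrA (splitr e) (le_lt_trans (ler_normD _ _))//.
by rewrite ltrD// distrC.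
Qed.

(** Serves twice: for characters along an ultrafilter, which gives compactness, and for point
    evaluations along a radial filter, which gives the characters at infinity. The value 1 at the
    unit keeps the limit nonzero. *)
Lemma limit_character T (F : set_system T) (u : T -> A -> C) : ProperFilter F ->
  (forall t (f g h : A), (forall x, val h x = val f x + val g x) ->
     u t h = u t f + u t g) ->
  (forall t c (f h : A), (forall x, val h x = c * val f x) ->
     u t h = c * u t f) ->
  (forall t (f g h : A), (forall x, val h x = val f x * val g x) ->
     u t h = u t f * u t g) ->
  (forall t, u t (elt A1) = 1) ->
  (forall a, exists l : C, u ^~ a @ F --> l) ->
  exists chi : spectrum A, forall a, u ^~ a @ F --> chi a.
Proof.
move=> PF uD uZ uM u1 ul.
have [l lP] := choice ul.
have lE (h : A) (c : C) (v : T -> C) : (forall t, u t h = v t) -> v @ F --> c -> l h = c.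
  move=> uv; have <- : u ^~ h = v by exact/funext.
  exact: (@cvgC_unique _ F (u ^~ h) _ _ PF (lP h)).
have lD (f g h : A) : (forall x, val h x = val f x + val g x) -> l h = l f + l g.
  move=> fgh; apply: (lE h _ (fun t => u t f + u t g)).
    by move=> t; exact: uD.
  exact: (@cvgD C C^o).
have lZ (c : C) (f h : A) : (forall x, val h x = c * val f x) -> l h = c * l f.
  move=> cfh; apply: (lE h _ (fun t => c * u t f)).
    by move=> t; exact: uZ.
  by apply: (@cvgM C _ F _ (fun=> c)); [exact: cvg_cst|exact: lP].
have lM (f g h : A) : (forall x, val h x = val f x * val g x) -> l h = l f * l g.
  move=> fgh; apply: (lE h _ (fun t => u t f * u t g)).
    by move=> t; exact: uM.
  exact: (@cvgM C).
have l1 : exists f : A, l f != 0.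
  exists (elt A1); rewrite (lE (elt A1) 1 (fun=> 1)) ?oner_eq0//.
  exact: cvg_cst.
by exists (Character lD lZ lM l1).
Qed.

(** Along an ultrafilter of characters the values at each [a] stay bounded, hence converge, and the
    limits assemble into a character. *)
Lemma compact_spectrum : compact [set: spectrum A].
Proof.
rewrite compact_ultra => U UU _.
have ul (a : A) : exists l : C, (fun chi : spectrum A => chi a) @ U --> l.
  have [M aM] := cstar_bounded HA (eltP a).
  by apply: (@bounded_ultra_cvgC _ _ U _ M) => chi; exact: char_bounded.
have [||||chi chiP] :=
  @limit_character _ U (fun (chi : spectrum A) (a : A) => chi a) _ _ _ _ _ ul.
- by move=> chi f g h; exact: charD.
- by move=> chi c f h; exact: charZ.
- by move=> chi f g h; exact: Defs.charM.
- by move=> chi; exact: char_one.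
by exists chi; split=> //; apply: spectrum_cvg.
Qed.

Variable ev : W -> spectrum A.
Hypothesis evE : forall x (a : A), ev x a = val a x.

Lemma cvg_eval chi : ev @ char_filter chi --> chi.
Proof.
have PF := char_filter_proper HA A1 chi.
apply: spectrum_cvg => a.
have -> : (fun psi : spectrum A => psi a) @ (ev @ char_filter chi) =
    val a @ char_filter chi.
  by apply/seteqP; split=> P; congr (char_filter chi _); apply/seteqP; split=> x;
    rewrite /preimage /= evE.
exact: cvg_char.
Qed.

Lemma dense_eval : dense (range ev).
Proof.
move=> O [chi Ochi] oO; have PF := char_filter_proper HA A1 chi.
have /filter_ex[x Ox] : char_filter chi (ev @^-1` O).
  exact: (@cvg_eval chi O (open_nbhs_nbhs (conj oO Ochi))).
 by exists (ev x); split=> //; exists x.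
Qed.

Lemma eval_continuous : continuous ev.
Proof.
apply: spectrum_continuous => a.
rewrite (_ : (fun t => ev t a) = val a); last by apply/funext => x; exact: evE.
by apply: bu_continuous; exact: (csub_bu HA (eltP a)).
Qed.

(** Arbitrarily near a cluster point y there are points where [a] is close to [chi a], and there it
    is also close to its value at y by continuity. *)
Lemma eval_cluster chi y : cluster (char_filter chi) y -> chi = ev y.
Proof.
have PF := char_filter_proper HA A1 chi.
move=> cl; apply: char_ext => a; rewrite evE; apply: eqC_dist => e e0.
have e20 : 0 < e / 2 by rewrite divr_gt0.
have /cvgC_dist/(_ _ e20) ax := cvg_char HA A1 (chi := chi) (a := a).
have /cvgC_dist/(_ _ e20) ay := bu_continuous (csub_bu HA (eltP a)) (x := y).
have [x [/= xa ya]] := cl _ _ ax ay.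
rewrite -(subrK (val a x) (chi a)) -addrA (splitr e) (le_lt_trans (ler_normD _ _))//.
by rewrite ltrD// distrC.
Qed.

(* If chi does not vanish on a bump function, its filter contains the compact
   support, hence clusters at a point y there and chi is the evaluation at y. *)
Lemma eval_open :
  (forall (U : set W) x, open U -> U x -> exists2 f, A f &
     f x != 0 /\ exists2 K, compact K & K `<=` U /\ forall y, f y != 0 -> K y) ->
  forall U, open U -> open (ev @` U).
Proof.
move=> bump U oU; rewrite openE => _ [x Ux <-].
have [f Af [fx0 [K cK [KU fK]]]] := bump U x oU Ux.
have nf : 0 < `|ev x (elt Af)| by rewrite evE normr_gt0.
have /cvgC_dist/(_ _ nf) := @char_eval_continuous (elt Af) (ev x).
apply: filterS => chi /= chix.
have chif : chi (elt Af) != 0.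
  by apply: contraTneq chix => ->; rewrite subr0 ltxx.
have PF := char_filter_proper HA A1 chi.
have FK : char_filter chi K.
  have nz : 0 < `|chi (elt Af)| by rewrite normr_gt0.
  have /cvgC_dist/(_ _ nz) := cvg_char HA A1 (chi := chi) (a := elt Af).
  apply: filterS => y /= fy; apply: fK; apply: contraTneq fy => ->; rewrite subr0.
  by rewrite ltxx.
have [y [Ky cly]] := cK _ _ FK.
by exists y; [exact: KU|rewrite (eval_cluster cly)].
Qed.

Lemma eval_inj : (forall x y, x != y -> exists2 f, A f & f x != f y) ->
  injective ev.
Proof.
move=> sep x y xy; have [//|/sep[f Af]] := eqVneq x y.
by rewrite -[f x](evE x (elt Af)) xy evE eqxx.
Qed.

Lemma eval_compactification :
  (forall x y, x != y -> exists2 f, A f & f x != f y) ->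
  (forall (U : set W) x, open U -> U x -> exists2 f, A f &
     f x != 0 /\ exists2 K, compact K & K `<=` U /\ forall y, f y != 0 -> K y) ->
  is_compactification ev.
Proof.
move=> sep bump; split; [exact: compact_spectrum|exact: spectrum_hausdorff| |].
  by split; [exact: eval_inj|exact: eval_continuous|exact: eval_open].
exact: dense_eval.
Qed.

End Spectrum.

(** * The radial compactification *)

Section HalfLines.
Context (R : realType).

Lemma half_line_id (Z : preTopologicalLmodType R) (a : Z) : half_line a a.
Proof. by exists 1 => //=; rewrite scale1r. Qed.

Lemma half_line_eq (Z : preTopologicalLmodType R) (a b : Z) : half_line a b ->
  half_line b = half_line a.
Proof.
move=> [r /= r0 <-]; apply/seteqP; split=> _ [s /= s0 <-].
  by exists (s * r); [exact: mulr_gt0|rewrite scalerA].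
exists (s / r); first exact: divr_gt0.
by rewrite scalerA divfK// gt_eqF.
Qed.

Definition inf_point (Z : preTopologicalLmodType R) (a : Z) (a0 : a != 0) :
    sphere_at_infinity Z :=
  exist _ (half_line a) (ex_intro2 _ _ a a0 erefl).

Lemma inf_pointP (Z : preTopologicalLmodType R) (h : sphere_at_infinity Z) :
  exists a (a0 : a != 0), h = inf_point a0.
Proof.
by case: h => h [a a0 hE]; exists a, a0; exact: eq_exist.
Qed.

Lemma inf_point_eq (Z : preTopologicalLmodType R) (a b : Z) (a0 : a != 0)
  (b0 : b != 0) : half_line a b -> inf_point b0 = inf_point a0.
Proof. by move/half_line_eq=> ab; apply: eq_exist. Qed.

Lemma inf_mem (Z : preTopologicalLmodType R) (h : sphere_at_infinity Z) (a : Z) :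
  sval h a -> exists a0 : a != 0, h = inf_point a0.
Proof.
have [b [b0 ->]] := inf_pointP h => /= ba.
have a0 : a != 0.
  by case: ba => r /= r0 <-; rewrite scaler_eq0 negb_or gt_eqF.
by exists a0; rewrite -(inf_point_eq b0 a0).
Qed.

End HalfLines.

Section SphericalMap.
Context (R : realType) (Z Z' : preTopologicalLmodType R) (psi : Z -> Z').
Hypotheses (psiZ : forall (r : R) x, psi (r *: x) = r *: psi x).
Hypothesis psi_neq0 : forall a, a != 0 -> psi a != 0.

Fact inf_map_subproof (h : sphere_at_infinity Z) :
  exists2 a, a != 0 & psi @` sval h = half_line a.
Proof.
have [a [a0 -> /=]] := inf_pointP h; exists (psi a); first exact: psi_neq0.
apply/seteqP; split=> [_ [_ [r r0 <-] <-]|_ [r r0 <-]].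
  by exists r => //; rewrite psiZ.
by exists (r *: a); [exists r|rewrite psiZ].
Qed.

Definition spherical_map (p : spherical Z) : spherical Z' :=
  match p with
  | inl z => inl (psi z)
  | inr h => inr (exist _ (psi @` sval h) (inf_map_subproof h))
  end.

(** Homogeneity carries the truncated cone over a neighbourhood of [psi a] back to the truncated
    cone over its preimage, with the same bound r0. *)
Lemma spherical_map_continuous : continuous psi -> continuous spherical_map.
Proof.
move=> cpsi; apply/continuousP => U [oU hU]; split.
  change (open (psi @^-1` (inl @^-1` U))).
  by move/continuousP: cpsi; apply.
move=> h Uh a ha.
have [|r0 H] := hU _ Uh (psi a); first by exists a.
exists r0; refine (@filterS _ (nbhs a) _ _ _ _ (cpsi a _ H)) => z [H1 H2]; split.
  by move=> h' h'z; apply: H1; exists z.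
by move=> r /H2; rewrite /preimage /= psiZ.
Qed.

Lemma spherical_map_surj : (forall y, exists x, psi x = y) -> psi 0 = 0 ->
  forall q, exists p, spherical_map p = q.
Proof.
move=> surj psi0 [y|h]; first by have [x <-] := surj y; exists (inl x).
have [b [b0 ->]] := inf_pointP h; have [a ab] := surj b.
have a0 : a != 0 by apply: contraNneq b0 => a0; rewrite -ab a0 psi0.
exists (inr (inf_point a0)); congr inr; apply: eq_exist => /=.
apply/seteqP; split=> [_ [_ [r r0 <-] <-]|_ [r r0 <-]].
  by exists r => //; rewrite psiZ ab.
by exists (r *: a); [exists r|rewrite psiZ ab].
Qed.

End SphericalMap.

Lemma vproj0 (R : realType) (W : topVectType R) (Y : {vspace W}) :
  vproj Y 0 = 0.
Proof. by apply: (addIr (vproj Y 0)); rewrite -vprojD !add0r. Qed.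

(** As Y is the kernel of [psi], there is an induced injective homogeneous map on W / Y, continuous
    for the quotient topology, and it extends to the radial compactifications. *)
Lemma radial_functions_linear (R : realType) (W : uniformVectType R)
    (Y : {vspace W}) (Z : preTopologicalLmodType R) (psi : {linear W -> Z})
    (g : spherical Z -> R[i]) :
  (forall x, (x \in Y) = (psi x == 0)) -> continuous psi -> continuous g ->
  radial_functions Y (fun x => g (inl (psi x))).
Proof.
move=> kerY cpsi cg.
pose psib (q : vquot Y) : Z := psi (generic_quotient.repr (q : Quotient.quot Y)).
have psibE x : psib (vproj Y x) = psi x.
  apply/eqP; rewrite -subr_eq0 -raddfB -kerY.
  by apply/vproj_eq; exact: vprojK.
have psibZ (r : R) q : psib (r *: q) = r *: psib q.
  rewrite -(vprojK q) psibE.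
  rewrite -[LHS]/(psib (vquot_scale r (vproj Y (generic_quotient.repr (q : Quotient.quot Y))))).
  by rewrite vquot_scaleE psibE linearZ.
have psib0 q : q != 0 -> psib q != 0.
  rewrite -(vprojK q) psibE; apply: contra_neq => /eqP; rewrite -kerY => q0.
  by rewrite -(vproj0 Y); apply/vproj_eq; rewrite subr0.
have cpsib : continuous psib.
  apply/continuousP => U oU; rewrite /open /= /vquot_open.
  have -> : vproj Y @^-1` (psib @^-1` U) = psi @^-1` U.
    by apply/seteqP; split=> x; rewrite /preimage /= psibE.
  by move/continuousP: cpsi; apply.
exists (g \o spherical_map psibZ psib0).
  move=> p; apply: continuous_comp; last exact: cg.
  exact: spherical_map_continuous.
by apply/funext => x /=; rewrite psibE.
Qed.

(** * The closed unit ball as a model of the radial compactification *)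

Section BallModel.
Context (R : realType) (V : normedModType R).
Implicit Types (p q : spherical V) (x y z w a : V).
Local Notation C := R[i].

(* ball_of and of_ball are mutually inverse bijections between spherical V and
   the closed unit ball; of_ball sends the outside of the ball to infinity. *)
Definition ball_of p : V :=
  match p with
  | inl z => (1 + `|z|)^-1 *: z
  | inr h => let a := projT1 (cid (inf_pointP h)) in `|a|^-1 *: a
  end.

Definition of_ball w : spherical V :=
  match pselect (w != 0) with
  | left w0 => if `|w| < 1 then inl ((1 - `|w|)^-1 *: w) else inr (inf_point w0)
  | right _ => inl 0
  end.

(** The representative picked by [cid] does not matter: it differs from [a] by a positive factor,
    which the normalisation cancels. *)
Lemma ball_of_inf a (a0 : a != 0) : ball_of (inr (inf_point a0)) = `|a|^-1 *: a.
Proof.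
rewrite /ball_of; case: cid => b [b0 /= ab].
have [r /= r0 <-] : half_line a b.
  have -> : half_line a = half_line b by case: ab.
  exact: half_line_id.
rewrite normrZ scalerA invfM gtr0_norm// mulrAC mulVf ?gt_eqF//.
by rewrite mul1r.
Qed.

Lemma ball_of_norm p : `|ball_of p| <= 1.
Proof.
case: p => [z|h].
  rewrite /= normrZ ger0_norm ?invr_ge0 ?addr_ge0//.
  by rewrite ler_pdivrMl ?ltr_wpDr// mulr1 lerDr.
have [a [a0 ->]] := inf_pointP h.
by rewrite ball_of_inf normrZ normfV normr_id mulVf ?normr_eq0.
Qed.

Lemma ball_ofK : cancel ball_of of_ball.
Proof.
case=> [z|h]; last first.
  have [a [a0 ->]] := inf_pointP h; rewrite ball_of_inf /of_ball.
  have n1 : `| `|a|^-1 *: a| = 1 by rewrite normrZ normfV normr_id mulVf ?normr_eq0.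
  case: pselect => [w0|w0]; last first.
    by exfalso; apply: w0; rewrite -normr_eq0 n1 oner_eq0.
  rewrite n1 ltxx; congr inr; apply: inf_point_eq.
  by exists (`|a|^-1) => //=; rewrite invr_gt0 normr_gt0.
have z1 : 0 < 1 + `|z| by rewrite ltr_wpDr.
have nz : `|(1 + `|z|)^-1 *: z| = `|z| / (1 + `|z|).
  by rewrite normrZ gtr0_norm ?invr_gt0// mulrC.
rewrite /ball_of /of_ball; case: pselect => [w0|/negP].
  rewrite nz ltr_pdivrMr// mul1r ltrDr ltr01; congr inl.
  have -> : 1 - `|z| / (1 + `|z|) = (1 + `|z|)^-1 by field; rewrite gt_eqF.
  by rewrite scalerA invrK mulfV ?scale1r// gt_eqF.
rewrite negbK scaler_eq0 invr_eq0 gt_eqF// => /eqP ->.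
by [].
Qed.

Lemma ball_of_inj : injective ball_of.
Proof. exact: can_inj ball_ofK. Qed.

(** For r > 0 the point r z goes to z / (1/r + |z|), so s = 1/r is a coordinate reaching infinity at
    s = 0. Finite and infinite points are both handled by continuity of u / (s + |u|), at s = 1 and
    at s = 0. *)
Lemma ball_of_continuous : continuous ball_of.
Proof.
have cone T (F : set_system T) (FF : Filter F) (s : T -> R) (u : T -> V) (s0 : R) a :
    0 <= s0 -> (0 < s0) || (a != 0) -> s @ F --> s0 -> u @ F --> a ->
    (fun t => (s t + `|u t|)^-1 *: u t) @ F --> (s0 + `|a|)^-1 *: a.
  move=> s00 s0a sF uF; apply: cvgZ (uF).
  apply: (@cvgV R T F _ (fun t => s t + `|u t|)).
    rewrite paddr_eq0// negb_and normr_eq0.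
    by rewrite lt0r s00 andbT in s0a.
  by apply: (@cvgD R R T F _ s (fun t => `|u t|) s0 `|a|) => //; exact: (@cvg_norm R V T F FF u a).
apply/continuousP => U oU; split.
  change (open ((fun z : V => (1 + `|z|)^-1 *: z) @^-1` U)).
  apply: open_comp => // z _.
  apply: (cone _ (nbhs z) _ (fun=> 1) id 1 z ler01 _ _ cvg_id).
    by rewrite ltr01.
  exact: cvg_cst.
move=> h Uh a ha; have [a0 hE] := inf_mem ha.
move: Uh; rewrite hE /preimage /= -/(ball_of (inr (inf_point a0))) ball_of_inf => Ua.
have := cone _ (nbhs (0 : R, a)) (nbhs_filter _) fst snd 0 a (lexx _).
rewrite a0 orbT add0r => /(_ isT cvg_fst cvg_snd U).
move=> /(_ (open_nbhs_nbhs (conj oU Ua))) [[P Q] /= [P0 Qa] PQ].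
have [d /= d0 dP] := P0.
(* The condition r > 1/d places 1/r within d of 0. *)
exists d^-1; apply: filterS Qa => z Qz; split.
  move=> h' h'z; have [z0 ->] := inf_mem h'z.
  rewrite /preimage -/(ball_of (inr (inf_point z0))) /= -/(ball_of (inr (inf_point z0))) ball_of_inf.
  have := PQ (0, z); rewrite /= add0r; apply; split=> //.
  exact: nbhs_singleton P0.
move=> r dr; have r0 : 0 < r by apply: lt_trans dr; rewrite invr_gt0.
have := PQ (r^-1, z); rewrite /preimage /= normrZ gtr0_norm// scalerA.
have -> : (1 + r * `|z|)^-1 * r = (r^-1 + `|z|)^-1.
  have -> : 1 + r * `|z| = r * (r^-1 + `|z|) by rewrite mulrDr divff ?gt_eqF.
  by rewrite invfM mulrAC mulVf ?mul1r// gt_eqF.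
apply; split=> //; apply: dP => /=.
by rewrite sub0r normrN gtr0_norm ?invr_gt0// invf_plt// posrE.
Qed.

Lemma of_ball_inl w : `|w| < 1 -> of_ball w = inl ((1 - `|w|)^-1 *: w).
Proof.
rewrite /of_ball => w1; case: pselect => [w0|/negP]; first by rewrite w1.
by rewrite negbK => /eqP ->; rewrite scaler0.
Qed.

Lemma of_ball_inr w (w0 : w != 0) : 1 <= `|w| -> of_ball w = inr (inf_point w0).
Proof.
rewrite /of_ball leNgt => /negbTE w1; case: pselect => [w0'|/(_ w0)//].
by rewrite w1; congr inr; apply: inf_point_eq; exact: half_line_id.
Qed.

Lemma of_ball_continuous : {within [set w : V | `|w| <= 1], continuous of_ball}.
Proof.
apply/subspace_continuousP => w w1 U.
rewrite nbhsE => -[G [oG Gw] GU].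
have {}Gw : G (of_ball w) := Gw.
suff : (of_ball @ within [set w : V | `|w| <= 1] (nbhs w)) G by exact: filterS.
change (\forall z \near w, `|z| <= 1 -> G (of_ball z)); case: (ltP `|w| 1) => w1'.
  have [oi _] := oG; move: Gw; rewrite of_ball_inl// => Gw.
  have c : (fun z : V => (1 - `|z|)^-1 *: z) @ w --> (1 - `|w|)^-1 *: w.
    apply: cvgZ; last exact: cvg_id.
    apply: (@cvgV R V (nbhs w) _ (fun z : V => 1 - `|z|)).
      by rewrite subr_eq0 gt_eqF.
    apply: (@cvgB R R V (nbhs w) _ (fun=> 1) (fun z : V => `|z|)); first exact: cvg_cst.
    by apply: cvg_norm; exact: cvg_id.
  have n1 : \forall z \near w, `|z| < 1.
    by apply: (@cvgr_norm_lt _ _ _ (nbhs w) _ id w); [exact: cvg_id|].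
  have nG := c _ (open_nbhs_nbhs (conj oi Gw)).
  near=> z => _; rewrite of_ball_inl; last by near: z.
  by near: z; exact: nG.
have w0 : w != 0 by rewrite -normr_gt0 (lt_le_trans ltr01).
move: Gw; rewrite (of_ball_inr w0)// => Gw.
have [_ /(_ _ Gw w (half_line_id w))[r0 H]] := oG.
(* For |z| < 1 beyond this radius, the scalar 1 / (1 - |z|) exceeds |r0| + 1 and hence r0, so
   [of_ball z] falls in the truncated cone. *)
have m0 : (1 - (`|r0| + 1)^-1) < `|w|.
  by rewrite (lt_le_trans _ w1')// gtrBl invr_gt0 ltr_wpDl.
have n1 : \forall z \near w, (1 - (`|r0| + 1)^-1) < `|z|.
  by apply: (@cvgr_norm_gt _ _ _ (nbhs w) _ id w); [exact: cvg_id|].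
have n0 : \forall z \near w, 0 < `|z|.
  apply: (@cvgr_norm_gt _ _ _ (nbhs w) _ id w); first exact: cvg_id.
  by rewrite normr_gt0.
near=> z => _.
have z0 : z != 0 by rewrite -normr_gt0; near: z.
have [H1 H2] : (forall h', sval h' z -> G (inr h')) /\
  (forall r : R, r0 < r -> G (inl (r *: z))) by near: z.
case: (ltP `|z| 1) => z1.
  rewrite of_ball_inl//; apply: H2.
  rewrite -[r0]invrK; apply: (@le_lt_trans _ _ (`|r0|)).
    by rewrite invrK ler_norm.
  apply: (@lt_trans _ _ (`|r0| + 1)); first by rewrite ltrDl.
  rewrite -[X in X < _]invrK ltf_pV2 ?posrE ?subr_gt0 ?invr_gt0 ?ltr_wpDl//.
  by rewrite ltrBlDr -ltrBlDl; near: z.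
by rewrite (of_ball_inr z0)//; apply: H1; exact: half_line_id.
Unshelve. all: by end_near. Qed.

(** Lets uniform continuity pass from the ball to V. Each of the two terms of the splitting below is
    at most |x - y|, whence the factor 2. *)
Lemma ball_of_lipschitz x y :
  `|ball_of (inl x) - ball_of (inl y)| <= 2 * `|x - y|.
Proof.
have x1 : 0 < 1 + `|x| by rewrite ltr_wpDr.
have y1 : 0 < 1 + `|y| by rewrite ltr_wpDr.
have -> : ball_of (inl x) - ball_of (inl y) = (1 + `|x|)^-1 *: (x - y) +
    ((`|y| - `|x|) / (1 + `|x|)) *: ball_of (inl y).
  rewrite /= scalerBr -addrA; congr (_ + _).
  rewrite scalerA -!scaleNr -scalerDl; congr (_ *: _); field.
  by rewrite !gt_eqF.
rewrite mulr_natl mulr2n (le_trans (ler_normD _ _))// lerD//.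
  rewrite normrZ gtr0_norm ?invr_gt0// ler_piMl// invf_le1//.
  by rewrite lerDl.
rewrite normrZ (le_trans (ler_piMr _ (ball_of_norm _)))//.
rewrite normrM [`|_^-1|]gtr0_norm ?invr_gt0//.
rewrite (le_trans (ler_piMr _ _)) ?invf_le1 ?lerDl//.
by rewrite distrC ler_dist_dist.
Qed.

End BallModel.

(** * Continuous functions on the radial compactification *)

Section ContinuousOnSpherical.
Context (R : realType) (V : normedModType R).
Local Notation C := R[i].
Implicit Types (p q : spherical V) (x y z w a : V).

Lemma real_complex_continuous : continuous (fun r : R => r%:C : C).
Proof.
move=> r; apply/cvgC_dist => e /posC_real[d d0 ->].
have /cvgrPdist_lt/(_ _ d0) : id @ r --> r by exact: cvg_id.
by apply: filterS => s /= rs; rewrite -rmorphB normC_real ltcR.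
Qed.

(** The distance to [ball_of p], measured in the ball, vanishes only at p. *)
Lemma spherical_separated p q : p != q ->
  exists2 g : spherical V -> C, continuous g & g p != g q.
Proof.
move=> pq; exists (fun r => (`|ball_of r - ball_of p|)%:C).
  move=> r; apply: (@continuous_comp _ _ _ (fun r => `|ball_of r - ball_of p|)
    (fun s : R => s%:C : C)); last exact: real_complex_continuous.
  apply: (@cvg_norm R V _ (nbhs r) _ (fun r => ball_of r - ball_of p)).
  apply: (@cvgB R V _ (nbhs r) _ (@ball_of R V) (fun=> ball_of p)).
    exact: ball_of_continuous.
  exact: cvg_cst.
rewrite subrr normr0; apply: contra_neq pq => /complexI/esym/eqP.
by rewrite normr_eq0 subr_eq0 => /eqP/ball_of_inj ->.
Qed.

(** A tent around x, extended by 0 to infinity; it vanishes on a truncated cone around every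
    direction, hence is continuous there. *)
Lemma spherical_bump x (r : R) : 0 < r ->
  exists2 g : spherical V -> C, continuous g &
    g (inl x) != 0 /\ forall y, g (inl y) != 0 -> `|x - y| < r.
Proof.
move=> r0; pose g p : C :=
  if p is inl z then (Num.max 0 (r - `|x - z|))%:C else 0.
exists g; last first.
  split=> [|y]; rewrite /g.
    rewrite subrr normr0 subr0 max_r ?ltW//.
    by apply: contra_neq (lt0r_neq0 r0) => /complexI.
  by apply: contra_neqT; rewrite -leNgt => yr; rewrite max_l// subr_le0.
have cg : continuous (fun z => g (inl z)).
  move=> z; apply: (@continuous_comp _ _ _ (fun z => Num.max 0 (r - `|x - z|))
    (fun s : R => s%:C : C)); last exact: real_complex_continuous.
  apply: (@continuous_max _ _ (fun=> 0) (fun z => r - `|x - z|)).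
    exact: cvg_cst.
  apply: (@cvgB R R _ (nbhs z) _ (fun=> r) (fun z => `|x - z|)).
    exact: cvg_cst.
  apply: (@cvg_norm R V _ (nbhs z) _ (fun z => x - z)).
  by apply: (@cvgB R V _ (nbhs z) _ (fun=> x) id); [exact: cvg_cst|exact: cvg_id].
apply/continuousP => U oU; split.
  by move/continuousP: cg => /(_ _ oU).
move=> h Uh a ha; have [a0 _] := inf_mem ha.
have na : 0 < `|a| by rewrite normr_gt0.
have na2 : `|a| / 2 < `|a| by rewrite ltr_pdivrMr// ltr_pMr// ltr1n.
(* If |z| > |a| / 2 and s exceeds this bound, then |s z| > r + |x|, so s z lies outside the tent. *)
exists ((r + `|x|) / (`|a| / 2)).
have n1 : \forall z \near a, `|a| / 2 < `|z|.
  by apply: (@cvgr_norm_gt _ _ _ (nbhs a) _ id a); [exact: cvg_id|].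
apply: filterS n1 => z az; split=> // s sr.
suff gz : g (inl (s *: z)) = 0 by change (U (g (inl (s *: z)))); rewrite gz.
rewrite /g max_l// subr_le0.
rewrite ltr_pdivrMr ?divr_gt0// in sr.
have s0 : 0 < s.
  rewrite -(pmulr_lgt0 _ (_ : 0 < `|a| / 2)) ?divr_gt0//.
  by rewrite (lt_trans _ sr)// ltr_wpDr.
rewrite distrC (le_trans _ (lerB_dist _ _))// lerBrDr (le_trans (ltW sr))//.
by rewrite normrZ gtr0_norm// ler_pM2l// ltW.
Qed.

Hypothesis cB : compact [set w : V | `|w| <= 1].

Lemma compact_spherical : compact [set: spherical V].
Proof.
have := continuous_compact (@of_ball_continuous R V) cB.
congr compact; apply/seteqP; split=> // p _.
by exists (ball_of p); [exact: ball_of_norm|exact: ball_ofK].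
Qed.

Variable g : spherical V -> C.
Hypothesis cg : continuous g.

Lemma spherical_bounded : exists M : R, forall p, `|g p| <= M%:C.
Proof.
have /compact_near_coveringP/(_ R (pinfty_nbhs R)
  (fun M p => `|g p| <= M%:C) _) := compact_spherical.
move=> H; have [p _|M [_ HM]] := H.
  have [b _ bE] : {b : R | 0 < b & `|g p| + 1 = b%:C}.
    by apply: posC_real; rewrite ltr_pwDr.
  have /cvgC_dist/(_ 1 ltr01) np := cg (x := p).
  exists ([set q | `|g p - g q| < 1], [set M | b < M]).
    by split=> //; exists b; split=> //; exact: num_real.
  move=> [q M] /= [pq bM].
  have bM' : b%:C <= M%:C :> C by rewrite lecR ltW.
  rewrite (le_trans _ bM')// -bE -lerBlDl.
  by rewrite (le_trans (lerB_dist _ _))// distrC ltW.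
by exists (M + 1) => p; apply: HM => //; rewrite ltrDl.
Qed.

(** Heine-Cantor for [g \o of_ball] on the compact ball, transported to V by the Lipschitz bound. *)
Lemma spherical_unif_continuous (e : C) : 0 < e ->
  exists2 d : R, 0 < d & forall x y, `|x - y| < d -> `|g (inl x) - g (inl y)| < e.
Proof.
move=> e0; pose B := [set w : V | `|w| <= 1].
pose P (d : R) w := forall w', B w' -> `|w - w'| < d ->
  `|g (of_ball w) - g (of_ball w')| < e.
have /compact_near_coveringP/near_covering_withinP/(_ R (0^'+) P _) := cB.
move=> H; have [w Bw|d0 [/= d00 Hd]] := H; last first.
  exists (d0 / 4); first by rewrite divr_gt0.
  move=> x y xy; have := Hd (d0 / 2).
  rewrite /= sub0r normrN gtr0_norm ?divr_gt0// ltr_pdivrMr// ltr_pMr// ltr1n.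
  move=> /(_ isT isT (ball_of (inl x)) (ball_of_norm _) (ball_of (inl y))
    (ball_of_norm _)).
  rewrite !ball_ofK; apply; apply: le_lt_trans (ball_of_lipschitz _ _) _.
  by rewrite -ltr_pdivlMl//; apply: lt_le_trans xy _; lra.
have e20 : 0 < e / 2 by rewrite divr_gt0.
have /cvgC_dist/(_ _ e20) : g \o @of_ball R V @ within B (nbhs w) --> g (of_ball w).
  have /subspace_continuousP/(_ w Bw) := @of_ball_continuous R V.
  by move=> /cvg_comp; apply; exact: cg.
rewrite /within /= => /nbhs_ballP[d /= d0 Hd].
have d20 : 0 < d / 2 by rewrite divr_gt0.
exists ([set w' | `|w - w'| < d / 2], [set d' | d' < d / 2]).
  split; first by have /cvgrPdist_lt/(_ _ d20) : id @ w --> w by exact: cvg_id.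
  exists (d / 2) => //= s /=; rewrite sub0r normrN => sd _.
  exact: le_lt_trans (ler_norm _) sd.
move=> [w1 d1] /= [ww1 d1d] Bw1 w2 Bw2 w12.
have h1 : `|g (of_ball w) - g (of_ball w1)| < e / 2.
  apply: Hd => //; rewrite -ball_normE /=; apply: lt_le_trans ww1 _.
  by rewrite ler_pdivrMr// ler_pMr// ler1n.
have h2 : `|g (of_ball w) - g (of_ball w2)| < e / 2.
  apply: Hd => //; rewrite -ball_normE /= (splitr d) -(subrK w1 w) -addrA.
  by rewrite (le_lt_trans (ler_normD _ _))// ltrD// (lt_trans w12).
rewrite -(subrK (g (of_ball w)) (g (of_ball w1))) -addrA (splitr e).
by rewrite (le_lt_trans (ler_normD _ _))// ltrD// distrC.
Qed.

End ContinuousOnSpherical.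

(** * Finite-dimensional spaces *)

(** The product uniformity is generated by finite intersections of pullbacks along projections, and
    one pullback is such an intersection. *)
Lemma prod_entourage (I : Type) (K : I -> uniformType) (i : I)
    (E : set (K i * K i)) : entourage E ->
  entourage [set xy : prod_topology K * prod_topology K | E (xy.1 i, xy.2 i)].
Proof.
move=> entE.
pose Tc := fun j => Uniform.class (initial_topology (@proj I K j)).
suff : @sup_ent (prod_topology K) I Tc
    [set xy : prod_topology K * prod_topology K | E (xy.1 i, xy.2 i)] by [].
have pf : `[< @entourage (Uniform.Pack (Tc i))
    [set xy : prod_topology K * prod_topology K | E (xy.1 i, xy.2 i)] >].
  by apply/asboolP; exists E.
exists [set xy : prod_topology K * prod_topology K | E (xy.1 i, xy.2 i)] => //.
match goal with |- @finI_from ?J _ _ ?f _ =>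
  exact: (@finI_from1 J _ setT f (exist _ ((i : {classic I}), _) pf) Logic.I) end.
Qed.

Section Coordinates.
Context (R : realType).

Section Comb.
Context (U : lmodType R) (k : nat) (c : 'I_k -> U).

Definition comb (v : 'rV[R]_k) : U := \sum_i v 0 i *: c i.

Fact comb_linear : linear comb.
Proof.
move=> a u v; rewrite /comb scaler_sumr -big_split /=.
by apply: eq_bigr => i _; rewrite !mxE scalerDl scalerA.
Qed.

HB.instance Definition _ := GRing.isLinear.Build R 'rV[R]_k U *:%R comb comb_linear.
End Comb.

Section Coords.
Context (W : vectType R) (E : {vspace W}).

Definition coords (x : W) : 'rV[R]_(\dim E) := \row_i coord (vbasis E) i x.

Fact coords_linear : linear coords.
Proof. by move=> a x y; apply/rowP => i; rewrite !mxE linearP. Qed.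

HB.instance Definition _ :=
  GRing.isLinear.Build R W 'rV[R]_(\dim E) *:%R coords coords_linear.

Definition of_coords : 'rV[R]_(\dim E) -> W := comb (fun i => (vbasis E)`_i).

HB.instance Definition _ := GRing.Linear.on of_coords.

Lemma coordsK x : x \in E -> of_coords (coords x) = x.
Proof.
move=> xE; rewrite [RHS](coord_vbasis xE) /of_coords /comb.
by apply: eq_bigr => i _; rewrite mxE.
Qed.

Lemma of_coordsK : cancel of_coords coords.
Proof.
move=> v; apply/rowP => i; rewrite mxE coord_sum_free//.
exact: basis_free (vbasisP E).
Qed.

Lemma of_coords_mem v : of_coords v \in E.
Proof.
apply: memv_suml => i _; apply: memvZ; apply: vbasis_mem; apply: mem_nth.
by rewrite size_tuple.
Qed.
End Coords.
Arguments coords {W} E x.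
Arguments of_coords {W} E v.

Lemma rV_norm_coord k (v : 'rV[R]_k) i : `|v 0 i| <= `|v|.
Proof.
have /mapP[j Hj ->] : `|v 0 i| \in [seq `|v x.1 x.2| | x : 'I_1 * 'I_k].
  by apply/mapP; exists (0, i) => //=; rewrite mem_enum.
by rewrite [leRHS]/Num.norm /= mx_normrE; apply/bigmax_geP; right => /=; exists j.
Qed.

Lemma bounded_linear_continuous (V U : normedModType R) (L : {linear V -> U}) M :
  (forall x, `|L x| <= M * `|x|) -> continuous L.
Proof.
move=> LM x; apply/cvgrPdist_lt => e e0.
have M1 : 0 < `|M| + 1 by rewrite ltr_wpDl.
have d0 : 0 < e / (`|M| + 1) by rewrite divr_gt0.
have /cvgrPdist_lt/(_ _ d0) : id @ x --> x by exact: cvg_id.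
apply: filterS => y /= xy; rewrite -linearB (le_lt_trans (LM _))//.
rewrite ltr_pdivlMr// in xy; apply: le_lt_trans xy.
by rewrite mulrC ler_wpM2l// (le_trans (ler_norm _))// lerDl.
Qed.

Lemma comb_continuous (U : normedModType R) k (c : 'I_k -> U) :
  continuous (comb c).
Proof.
apply: (@bounded_linear_continuous _ _ _ (\sum_i `|c i|)) => v.
rewrite (le_trans (ler_norm_sum _ _ _))// mulr_suml ler_sum// => i _.
by rewrite normrZ mulrC ler_wpM2l// rV_norm_coord.
Qed.

Lemma compact_rV_ball k (a : 'rV[R]_k) (r : R) : compact [set v | `|a - v| <= r].
Proof.
apply: bounded_closed_compact.
  exists (`|a| + r); split; first exact: num_real.
  move=> M rM v /= av; rewrite -(subKr a v) (le_trans (ler_normB _ _))//.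
  by rewrite (le_trans _ (ltW rM))// lerD2l.
have /continuous_closedP/(_ _ (closed_le (y := r))) : continuous (fun v : 'rV[R]_k => `|a - v|); last exact.
move=> v; apply: (@cvg_norm R _ _ (nbhs v) _ (fun v => a - v)).
by apply: (@cvgB R _ _ (nbhs v) _ (fun=> a) id); [exact: cvg_cst|exact: cvg_id].
Qed.

(* |comb b| attains a positive minimum on the unit sphere of 'rV_d. *)
Lemma coords_bounded (X : normedVectType R) :
  exists2 M, 0 < M & forall x : X, `|coords fullv x| <= M * `|x|.
Proof.
pose T : 'rV[R]_(\dim (fullv : {vspace X})) -> X := of_coords _.
pose S := [set v : 'rV[R]_(\dim (fullv : {vspace X})) | `|v| = 1].
(* The unit sphere is empty only in dimension 0, where all coordinate vectors vanish and any
   constant works. *)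
have [[v0 Sv0]|S0] := pselect (S !=set0); last first.
  exists 1 => // x; have [->|n0] := eqVneq (coords fullv x) 0.
    by rewrite normr0 mul1r.
  exfalso; apply: S0; exists (`|coords fullv x|^-1 *: coords fullv x).
  by rewrite /S /= normrZ normfV normr_id mulVf ?normr_eq0.
have cS : compact S.
  apply: (subclosed_compact _ (@compact_rV_ball _ 0 1)) => [|v /= <-]; last first.
    by rewrite sub0r normrN.
  have /continuous_closedP/(_ _ (closed_eq (y := 1 : R))) :
    continuous (fun v : 'rV[R]_(\dim (fullv : {vspace X})) => `|v|); last exact.
  by move=> v; apply: (@cvg_norm R _ _ (nbhs v) _ id v); exact: cvg_id.
have cT : continuous (fun v => `|T v|).
  move=> v; apply: (@cvg_norm R X _ (nbhs v) _ T).
  exact: comb_continuous.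
have [v /[!inE] Sv vmin] := compact_EVT_min (ex_intro _ v0 Sv0) cS
  (continuous_subspaceT cT).
have Tv : 0 < `|T v|.
  rewrite normr_gt0; apply: contra_eq_neq (Sv : `|v| = 1) => Tv0.
  by rewrite -(of_coordsK v) -/(T v) Tv0 linear0 normr0 eq_sym oner_eq0.
exists `|T v|^-1 => [|x]; first by rewrite invr_gt0.
have [->|n0] := eqVneq (coords fullv x) 0.
  by rewrite normr0 mulr_ge0 ?invr_ge0.
have := vmin (`|coords fullv x|^-1 *: coords fullv x).
rewrite !inE /S /= normrZ normfV normr_id mulVf ?normr_eq0// => /(_ erefl).
rewrite /T linearZ /= coordsK ?memvf// normrZ normfV normr_id.
rewrite ler_pdivlMl ?normr_gt0// => H.
by rewrite ler_pdivlMl// mulrC.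
Qed.

Lemma linear_bounded (X : normedVectType R) (U : normedModType R)
  (L : {linear X -> U}) : exists2 M, 0 < M & forall x, `|L x| <= M * `|x|.
Proof.
have [K K0 HK] := coords_bounded X.
pose b i := L (vbasis (fullv : {vspace X}))`_i.
have S0 : 0 <= \sum_(i < \dim (fullv : {vspace X})) `|b i| by exact: sumr_ge0.
exists ((\sum_(i < \dim (fullv : {vspace X})) `|b i| + 1) * K) => [|x].
  by rewrite mulr_gt0// ltr_wpDl.
rewrite -{1}(coordsK (memvf x)) /of_coords /comb linear_sum.
rewrite (le_trans (ler_norm_sum _ _ _))// -mulrA.
rewrite (le_trans _ (ler_wpM2l _ (HK x))) ?addr_ge0//.
rewrite mulrDl mul1r ler_wpDr// mulr_suml ler_sum// => i _.
by rewrite linearZ normrZ mulrC ler_wpM2l// rV_norm_coord.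
Qed.

End Coordinates.
Arguments coords {R W} E x.
Arguments of_coords {R W} E v.

Section PowerSpace.
Context (R : realType) (X : normedVectType R) (n : nat).
Local Notation W := (power X n).

Lemma power_entourage (d : R) : 0 < d ->
  entourage [set xy : W * W | forall i, `|xy.1 i - xy.2 i| < d].
Proof.
move=> d0.
refine (@filter_forall _ 'I_n
  (fun i => [set xy : W * W | `|xy.1 i - xy.2 i| < d]) entourage _ _) => i.
exists [set xy : prod_topology (fun _ : 'I_n => X) *
  prod_topology (fun _ : 'I_n => X) | `|xy.1 i - xy.2 i| < d] => //.
apply: (@prod_entourage _ (fun _ : 'I_n => (X : uniformType)) i
  [set xy | `|xy.1 - xy.2| < d]).
by rewrite -(@entourage_ballE R X); exists d => // -[x y]; rewrite -ball_normE.
Qed.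

Lemma coord_power_continuous i : continuous (fun x : W => x i : X).
Proof.
move=> x.
have ci := @initial_continuous W (prod_topology (fun _ : 'I_n => X))
  (fun x => x : 'I_n -> X).
exact: (continuous_comp (ci x) (@proj_continuous 'I_n (fun=> X) i _)).
Qed.

Lemma to_power_continuous (T : topologicalType) (u : T -> W) :
  (forall i, continuous (fun t => u t i : X)) -> continuous u.
Proof.
move=> cu t; apply: cvg_initial; apply/cvg_sup => i.
apply: (@cvg_initial _ _ (@^~ i)); exact: cu.
Qed.

(** [power X n] carries a uniform structure but no norm, so a common bound r of the coordinates
    stands in for the norm. The estimate is summed over the n embeddings of X. *)
Lemma power_linear_bounded (U : normedModType R) (L : {linear W -> U}) :
  exists2 M, 0 < M & forall (x : W) (r : R), 0 <= r -> (forall i, `|x i| <= r) ->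
    `|L x| <= M * r.
Proof.
pose inj i (a : X) : W := [ffun j => if j == i then a else 0].
have injP i : linear (inj i).
  move=> a x y; apply/ffunP => j; rewrite !ffunE.
  by case: eqP => _; rewrite ?scaler0 ?addr0.
have LinjP i : linear (L \o inj i) by move=> a x y; rewrite /= injP linearP.
have HM i : exists2 M, 0 < M & forall x, `|L (inj i x)| <= M * `|x|.
  pose l := GRing.isLinear.Build _ _ _ _ _ (LinjP i).
  pose f : {linear X -> U} := HB.pack (L \o inj i) l.
  exact: (linear_bounded f).
have /choice[M HM'] : forall i, exists M, 0 < M /\ forall x, `|L (inj i x)| <= M * `|x|.
  by move=> i; have [M M0 ?] := HM i; exists M.
have S0 : 0 <= \sum_i M i by apply: sumr_ge0 => i _; exact: ltW (HM' i).1.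
exists (\sum_i M i + 1) => [|x r r0 xr]; first by rewrite ltr_wpDl.
have -> : x = \sum_i inj i (x i).
  apply/ffunP => j; rewrite sum_ffunE (bigD1 j)//= ffunE eqxx big1 ?addr0//.
  by move=> i ij; rewrite ffunE eq_sym (negbTE ij).
rewrite linear_sum (le_trans (ler_norm_sum _ _ _))//.
rewrite mulrDl mul1r ler_wpDr// mulr_suml ler_sum// => i _.
rewrite (le_trans ((HM' i).2 _))// ler_wpM2l//.
exact: ltW (HM' i).1.
Qed.

End PowerSpace.

(** * The compactifications of powers of X *)

Section PowerRadial.
Context (R : realType) (X : normedVectType R) (n : nat).
Local Notation W := (power X n).

Lemma power_linear_entourage (U : normedModType R) (L : {linear W -> U}) (d : R) :
  0 < d -> entourage [set xy : W * W | `|L xy.1 - L xy.2| < d].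
Proof.
move=> d0; have [M M0 LM] := power_linear_bounded L.
have e0 : 0 < d / (2 * M) by rewrite divr_gt0// mulr_gt0.
refine (@filterS _ (@entourage W) _ _ _ _ (@power_entourage R X n _ e0)) => -[x y] /= xy.
rewrite -linearB (le_lt_trans (LM _ _ (ltW e0) _))//.
  by move=> i; rewrite !ffunE; exact: ltW (xy i).
rewrite [ltLHS](_ : _ = d / 2); last by field; rewrite gt_eqF.
by rewrite ltr_pdivrMr// ltr_pMr// ltr1n.
Qed.

Lemma power_linear_continuous (U : normedModType R) (L : {linear W -> U}) :
  continuous L.
Proof.
move=> x; have FF := @nbhs_filter (W : uniformType) x.
apply/(@cvgrPdist_lt _ _ _ (nbhs (x : (W : uniformType)))) => e e0.
refine (@filterS _ (nbhs x) _ _ _ _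
  (nbhs_entourage x (power_linear_entourage L e0))) => y.
by rewrite /xsection /= in_setE.
Qed.

Lemma of_coords_continuous (E : {vspace W}) : continuous (of_coords E).
Proof.
apply: to_power_continuous => i.
rewrite (_ : (fun t => _) = comb (fun j => (vbasis E)`_j i : X)).
  exact: comb_continuous.
apply/funext => v; rewrite /of_coords /comb sum_ffunE.
by apply: eq_bigr => j _; rewrite ffunE.
Qed.

Lemma compact_rV_unit_ball k : compact [set v : 'rV[R]_k | `|v| <= 1].
Proof.
have := @compact_rV_ball R k 0 1.
by congr compact; apply/seteqP; split=> v /=; rewrite sub0r normrN.
Qed.

Lemma vproj_continuous (Y : {vspace W}) : continuous (@vproj R W Y).
Proof. by apply/continuousP. Qed.

(* W / Y is identified with 'rV_k through a complement of Y, the image of the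
   projection 1 - projv Y. *)
Lemma radial_functions_bu (Y : {vspace W}) :
  radial_functions Y `<=` @bounded_uniformly_continuous R W.
Proof.
move=> _ [g cg ->].
pose p : 'End(W) := (\1 - projv Y)%VF.
have pE x : p x = x - projv Y x by rewrite /p !lfunE /= opp_lfunE id_lfunE.
have pid x : p (p x) = p x.
  by rewrite !pE linearB /= (projv_id (memv_proj _ _)) subrr subr0.
pose E := limg p.
pose L : {linear W -> 'rV[R]_(\dim E)} := coords E \o p.
pose psi (v : 'rV[R]_(\dim E)) : vquot Y := vproj Y (of_coords E v).
have psiZ (r : R) v : psi (r *: v) = r *: psi v.
  by rewrite /psi linearZ /= -[RHS]/(vquot_scale r _) vquot_scaleE.
(* A vector of E lying in Y is both fixed and killed by the idempotent p, hence is 0. *)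
have psi0 v : v != 0 -> psi v != 0.
  apply: contra_neq; rewrite -(vproj0 Y) => /vproj_eq; rewrite subr0 => vY.
  have /memv_imgP[w _ vw] := @of_coords_mem _ _ E v.
  rewrite -(@of_coordsK _ _ E v) [of_coords E v](_ : _ = 0) ?linear0//.
  by rewrite vw -pid -vw pE projv_id// subrr.
have cpsi : continuous psi.
  move=> v; apply: continuous_comp; first exact: of_coords_continuous.
  exact: vproj_continuous.
(* [L x] holds the coordinates of x - projv Y x, which represents the class of x. *)
have psiL x : psi (L x) = vproj Y x.
  rewrite /psi /L /= coordsK ?memv_img ?memvf//.
  by apply/vproj_eq; rewrite pE addrAC subrr sub0r memvN memv_proj.
pose g' := g \o @spherical_map R ('rV[R]_(\dim E) : normedModType R) (vquot Y) psi psiZ psi0.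
have cg' : continuous g'.
  move=> q; apply: continuous_comp; last exact: cg.
  exact: spherical_map_continuous.
have fE x : g (spherical_in (vproj Y x)) = g' (inl (L x)).
  by rewrite /g' /= psiL.
have cB := @compact_rV_unit_ball (\dim E).
split; last first.
  by have [M gM] := spherical_bounded cB cg'; exists M => x; rewrite fE.
apply/unif_continuousC => e e0.
have [d d0 gd] := spherical_unif_continuous cB cg' e0.
refine (@filterS _ (@entourage W) _ _ _ _ (power_linear_entourage L d0)).
by move=> [x y] /= /gd; rewrite !fE.
Qed.

End PowerRadial.

(** * The spectrum as a compactification of X^n *)

Section OmegaCompactification.
Context (R : realType) (X : normedVectType R) (n : nat) (n0 : (0 < n)%N).
Local Notation W := (power X n).
Local Notation S := (@collision_lattice R X n).
Local Notation A := (spherical_algebra S).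

Lemma collision_cap : semilattice S.
Proof. by move=> Y Z SY SZ M MS; apply: MS.1; [exact: SY|exact: SZ]. Qed.

Lemma collision_coord0 i : S (@Defs.coord0 R X n i).
Proof. by apply: sub_gen_smallest; left; exists i. Qed.

Lemma collision_coord_eq (i j : 'I_n) : i != j -> S (@coord_eq R X n i j).
Proof. by move=> ij; apply: sub_gen_smallest; right; exists (i, j). Qed.

(** The zero subspace is the intersection of all the x_i = 0. Only binary intersections are
    available, so the induction starts from one generator, given by n > 0. *)
Lemma collision_zero : exists2 Y, S Y & forall x, (x \in Y) = (x == 0).
Proof.
pose i0 := Ordinal n0.
have H s : exists2 Y, S Y &
    forall x : W, (x \in Y) = all (fun i => x i == 0) (i0 :: s).
  elim: s => [|i s [Y SY YE]].
    exists (@Defs.coord0 R X n i0); first exact: collision_coord0.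
    by move=> x; rewrite mem_coord0 /= andbT.
  exists (@Defs.coord0 R X n i :&: Y)%VS; first by apply: collision_cap => //; exact: collision_coord0.
  by move=> x; rewrite memv_cap mem_coord0 YE /= andbCA.
have [Y SY YE] := H (enum 'I_n); exists Y => // x; rewrite YE.
apply/idP/eqP => [|->].
  move=> /= /andP[_ /allP x0]; apply/ffunP => i; rewrite ffunE.
  by apply/eqP/x0; rewrite mem_enum.
by apply/allP => i _; rewrite ffunE.
Qed.

Lemma spherical_algebra_cstar : is_cstar_subalgebra A.
Proof.
apply: cstar_generated_cstar => f [Y _ fY]; exact: radial_functions_bu fY.
Qed.

Let A1 : A (fun=> 1) := spherical_algebra1 (@collision_lattice_neq0 R X n n0).

Lemma spherical_algebra_linear (Y : {vspace W}) (Z : preTopologicalLmodType R)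
    (psi : {linear W -> Z}) (g : spherical Z -> R[i]) :
  S Y -> (forall x, (x \in Y) = (psi x == 0)) -> continuous psi ->
  continuous g -> A (fun x => g (inl (psi x))).
Proof.
move=> SY Ypsi cpsi cg; apply: sub_gen_smallest; exists Y => //.
exact: radial_functions_linear.
Qed.

(** Because the zero subspace is in the lattice, A contains all continuous functions on the radial
    compactification of X^n itself, read in linear coordinates; among these are enough separating
    and bump functions. *)
Lemma Omega_compactification : is_compactification (@Omega_in R X n n0).
Proof.
pose V : normedModType R := 'rV[R]_(\dim (fullv : {vspace W})).
pose L : {linear W -> V} := coords fullv.
have Linj : injective L.
  by apply: (can_inj (g := of_coords fullv)) => x; rewrite coordsK ?memvf.
have [Y SY YE] := collision_zero.
have AL (g : spherical V -> R[i]) : continuous g -> A (fun x => g (inl (L x))).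
  apply: spherical_algebra_linear SY _ (@power_linear_continuous _ _ _ _ L) => x.
  by rewrite YE -(inj_eq Linj) linear0.
apply: (eval_compactification spherical_algebra_cstar A1) => //.
  move=> x y xy.
  have [|g cg gxy] := @spherical_separated R V (inl (L x)) (inl (L y)).
    by apply: contra_neq xy => -[/Linj].
  by exists (fun x => g (inl (L x))) => //; exact: AL.
move=> U x oU Ux.
have /nbhs_ballP[r /= r0 rU] : nbhs (L x) (of_coords fullv @^-1` U).
  apply: (@of_coords_continuous R X n fullv (L x)).
  by rewrite coordsK ?memvf//; exact: open_nbhs_nbhs.
(* Halving r puts the closed ball, compact in coordinates, inside the open ball that is mapped into
   U. *)
have r20 : 0 < r / 2 by rewrite divr_gt0.
have [g cg [gx gr]] := @spherical_bump R V (L x) _ r20.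
exists (fun x => g (inl (L x))); first exact: AL.
split=> //; exists (of_coords fullv @` [set v | `|L x - v| <= r / 2]).
  apply: continuous_compact; last exact: compact_rV_ball.
  by apply: continuous_subspaceT; exact: of_coords_continuous.
split=> [_ [v /= xv <-]|y /gr Ly].
  apply: (rU v); rewrite -ball_normE /= (le_lt_trans xv)//.
  by rewrite ltr_pdivrMr// ltr_pMr// ltr1n.
by exists (L y); [exact: ltW|rewrite coordsK ?memvf].
Qed.

End OmegaCompactification.

(** * Maps induced by linear maps *)

Section CharacterPullback.
Context (R : realType) (W W' : uniformType).
Context (A : set (W -> R[i])) (A' : set (W' -> R[i])) (phi : W -> W').
Hypothesis A1 : A (fun=> 1).
Hypothesis A'1 : A' (fun=> 1).
Hypothesis AA' : forall f, A' f -> A (f \o phi).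

Definition elt_pull (a : A') : A := elt (AA' (eltP a)).

Section CharPull.
Variable chi : spectrum A.

Let chi_pull (a : A') : R[i] := chi (elt_pull a).

Fact chi_pull_neq0 : exists a, chi_pull a != 0.
Proof.
exists (elt A'1); rewrite /chi_pull (_ : elt_pull _ = elt A1) ?char_one ?oner_eq0//.
exact: val_inj.
Qed.

Definition char_pull : spectrum A' := @Character R W' A' chi_pull
  (fun f g h fgh => @charD _ _ _ chi (elt_pull f) (elt_pull g) (elt_pull h) (fun x => fgh (phi x)))
  (fun c f h cfh => @charZ _ _ _ chi c (elt_pull f) (elt_pull h) (fun x => cfh (phi x)))
  (fun f g h fgh => @Defs.charM _ _ _ chi (elt_pull f) (elt_pull g) (elt_pull h) (fun x => fgh (phi x)))
  chi_pull_neq0.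
End CharPull.

Lemma char_pull_continuous : continuous char_pull.
Proof. by apply: spectrum_continuous => a; exact: char_eval_continuous. Qed.

End CharacterPullback.

Section OmegaMaps.
Context (R : realType) (X : normedVectType R) (n m : nat).
Context (n0 : (0 < n)%N) (m0 : (0 < m)%N).
Variable phi : {linear power X n -> power X m}.
Local Notation S := (@collision_lattice R X n).
Local Notation S' := (@collision_lattice R X m).
Hypothesis phi0 : forall j, exists2 Y, S Y & forall x, (x \in Y) = (phi x j == 0).
Hypothesis phi_eq : forall i j, i != j ->
  exists2 Y, S Y & forall x, (x \in Y) = (phi x i == phi x j).

(** By minimality of the lattice: the subspaces whose preimage lies in S form a semilattice, and it
    contains the generators by [phi0] and [phi_eq]. *)
Lemma collision_preimage Y' : S' Y' ->
  exists2 Y, S Y & forall x, (x \in Y) = (phi x \in Y').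
Proof.
move=> SY'; apply: (SY' [set Y' : {vspace power X m} |
  exists2 Y, S Y & forall x, (x \in Y) = (phi x \in Y')]); split.
  move=> Y1 Y2 [Z1 S1 E1] [Z2 S2 E2]; exists (Z1 :&: Z2)%VS.
    exact: collision_cap.
  by move=> x; rewrite !memv_cap E1 E2.
move=> _ [[j _ <-]|[[i j] /= ij <-]].
  have [Y SY YE] := phi0 j; exists Y => // x.
  by rewrite mem_coord0.
have [Y SY YE] := phi_eq ij; exists Y => // x.
by rewrite mem_coord_eq.
Qed.

Hypothesis cphi : continuous phi.

(** By minimality of the generated algebra. On a generator, the composite of [phi] with the
    projection to W' / Y' is linear, and its kernel is a member of S. *)
Lemma spherical_algebra_pull (f : power X m -> R[i]) :
  spherical_algebra S' f -> spherical_algebra S (f \o phi).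
Proof.
have HA := @spherical_algebra_cstar R X n.
(* Bounded uniform continuity is part of B because being a C*-subalgebra demands it on the target
   space. *)
pose B := [set f : power X m -> R[i] | bounded_uniformly_continuous f /\
  spherical_algebra S (f \o phi)].
have bu := @bu_cstar_subalgebra R (power X m).
suff HB : is_cstar_subalgebra B.
  move=> /(_ B) []//; split=> // {}f [Y' SY' fY'].
  split; first exact: radial_functions_bu fY'.
  have [Y SY YE] := collision_preimage SY'.
  case: fY' => g cg ->.
  have lin : linear (vproj Y' \o phi).
    move=> a x y; rewrite /= linearP vprojD; congr (_ + _).
    by rewrite -[RHS]/(vquot_scale a _) vquot_scaleE.
  pose l := GRing.isLinear.Build _ _ _ _ _ lin.
  pose psi : {linear power X n -> vquot Y'} := HB.pack (vproj Y' \o phi) l.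
  apply: (@spherical_algebra_linear R X n Y (vquot Y') psi g SY) => // [x|].
    rewrite YE; apply/idP/eqP; rewrite /= -(vproj0 Y') => pY.
      by apply/vproj_eq; rewrite subr0.
    by move/vproj_eq: pY; rewrite subr0.
  move=> x; apply: continuous_comp; first exact: cphi.
  exact: vproj_continuous.
split=> [h []//| |h k [bh Ah] [bk Ak]|h k [bh Ah] [bk Ak]|c h [bh Ah]|h [bh Ah]|].
- by split; [exact: csub0 bu|exact: csub0 HA].
- by split; [exact: (csubD bu)|exact: (csubD HA Ah Ak)].
- by split; [exact: (csubM bu)|exact: (csubM HA Ah Ak)].
- by split; [exact: (csubZ bu)|exact: (csubZ HA c Ah)].
- by split; [exact: (csub_conj bu)|exact: (csub_conj HA Ah)].
apply/uniform_closedC => h Hh; split.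
  apply: (iffLR (uniform_closedC _) (csub_closed bu)) => e e0.
  by have [k [bk _] hk] := Hh _ e0; exists k.
apply: (iffLR (uniform_closedC _) (csub_closed HA)) => e e0.
have [k [_ Ak] hk] := Hh _ e0; exists (k \o phi) => // x.
exact: hk.
Qed.

Definition Omega_map : Omega X n -> Omega X m :=
  char_pull (spherical_algebra1 (collision_lattice_neq0 X n0))
    (spherical_algebra1 (collision_lattice_neq0 X m0)) spherical_algebra_pull.

Lemma Omega_map_continuous : continuous Omega_map.
Proof. exact: char_pull_continuous. Qed.

Lemma Omega_map_in x : Omega_map (Omega_in n0 x) = Omega_in m0 (phi x).
Proof. exact: char_ext. Qed.

Lemma Omega_mapE chi a (f : power X n -> R[i]) (Af : spherical_algebra S f) :
  (forall x, val a (phi x) = f x) -> Omega_map chi a = chi (elt Af).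
Proof.
by move=> af; congr (chi _); apply: val_inj; apply/funext => x; exact: af.
Qed.

End OmegaMaps.

(** * The case n = 1 *)

Section RadialFilter.
Context (R : realType) (V : normedModType R).
Implicit Types (p : spherical V).

(** For p at infinity, limits along this filter are the radial limits in the direction p. *)
Definition radial_filter p : set_system V := filter_from (nbhs p) (preimage inl).

Lemma open_inl (U : set V) : open U -> open (inl @` U : set (spherical V)).
Proof.
move=> oU; split; last by move=> h [].
rewrite (_ : _ @^-1` _ = U)//; apply/seteqP; split=> [x [y Uy [<-]]//|x Ux].
by exists x.
Qed.

(** Properness is density of V: a neighbourhood of a direction contains far points of its
    half-line. *)
Global Instance radial_filter_proper p : ProperFilter (radial_filter p).
Proof.
apply: filter_from_proper; first apply: filter_from_filter.
- by exists setT; exact: filterT.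
- by move=> P Q Pp Qp; exists (P `&` Q) => //; exact: filterI.
move=> P; rewrite nbhsE => -[Q [[oQ hQ] Qp] QP].
case: p Qp => [x|h] Qp; first by exists x; exact: QP.
have [a [a0 hE]] := inf_pointP h.
have [|r0 /nbhs_singleton[_ H]] := hQ _ Qp a; first by rewrite hE; exact: half_line_id.
by exists ((r0 + 1) *: a); apply: QP; apply: H; rewrite ltrDl.
Qed.

Lemma radial_filter_inl x : radial_filter (inl x) --> x.
Proof.
move=> P; rewrite nbhsE => -[Q [oQ Qx] QP].
exists (inl @` Q).
  by apply: open_nbhs_nbhs; split; [exact: open_inl|exists x].
by move=> y [z Qz [<-]]; exact: QP.
Qed.

Lemma radial_cvg (U : topologicalType) (g : spherical V -> U) p :
  continuous g -> (g \o inl) @ radial_filter p --> g p.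
Proof. by move=> cg P /cg gP; exists (g @^-1` P). Qed.

End RadialFilter.

Section SphericalOmega.
Context (R : realType) (X : normedVectType R).
Local Notation C := R[i].
Local Notation W := (power X 1).
Local Notation S := (@collision_lattice R X 1).
Local Notation A := (spherical_algebra S).

Definition cst_power (x : X) : W := [ffun=> x].

Lemma cst_power_continuous : continuous cst_power.
Proof.
apply: to_power_continuous => i.
rewrite (_ : (fun t => _) = id) => [x|]; first exact: cvg_id.
by apply/funext => x; rewrite ffunE.
Qed.

Lemma power1_cst (y : W) : y = cst_power (y 0).
Proof. by apply/ffunP => i; rewrite ffunE (ord1 i). Qed.

(** For n = 1 no pair of distinct indices exists, so x_0 = 0 is the only generator. *)
Lemma collision1 Y x : S Y -> x \in Y -> x = 0.
Proof.
move=> SY; apply: (SY [set Y : {vspace W} | forall x, x \in Y -> x = 0]); split.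
  by move=> Y1 Y2 H1 _ y; rewrite memv_cap => /andP[/H1].
move=> _ [[j _ <-]|[[i j] /= ij <-]].
  move=> y; rewrite mem_coord0 => /eqP yj.
  by apply/ffunP => i; rewrite (ord1 i) -(ord1 j) yj ffunE.
by move: ij; rewrite !ord1 eqxx.
Qed.

(** Minimality again: functions with a limit at p form a C*-subalgebra. Generators have one because
    W -> W / Y is injective here and extends to infinity. *)
Lemma spherical_algebra_limit f p : A f ->
  exists l : C, (f \o cst_power) @ radial_filter p --> l.
Proof.
have bu := @bu_cstar_subalgebra R W.
pose B := [set f : W -> C | bounded_uniformly_continuous f /\
  exists l : C, (f \o cst_power) @ radial_filter p --> l].
suff HB : is_cstar_subalgebra B.
  move=> /(_ B) []//; split=> // {}f [Y SY fY].
  split; first exact: radial_functions_bu fY.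
  case: fY => g cg ->.
  pose psi x : vquot Y := vproj Y (cst_power x).
  have psiZ (r : R) x : psi (r *: x) = r *: psi x.
    rewrite -[RHS]/(vquot_scale r _) vquot_scaleE; congr vproj.
    by apply/ffunP => i; rewrite !ffunE.
  have psi0 x : x != 0 -> psi x != 0.
    apply: contra_neq; rewrite -(vproj0 Y) => /vproj_eq; rewrite subr0 => /(collision1 SY).
    by move=> /ffunP/(_ 0); rewrite !ffunE.
  have cpsi : continuous psi.
    move=> x; apply: continuous_comp; first exact: cst_power_continuous.
    exact: vproj_continuous.
  pose g' := g \o @spherical_map R X (vquot Y) psi psiZ psi0.
  exists (g' p); apply: (@radial_cvg R X _ g') => q.
  by apply: continuous_comp; [exact: spherical_map_continuous|exact: cg].
split=> [h []//| |h k [bh [l hl]] [bk [l' kl]]|h k [bh [l hl]] [bk [l' kl]]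
  |c h [bh [l hl]]|h [bh [l hl]]|].
- by split; [exact: csub0 bu|exists 0; exact: cvg_cst].
- by split; [exact: (csubD bu bh bk)|exists (l + l'); exact: cvgC_add hl kl].
- by split; [exact: (csubM bu bh bk)|exists (l * l'); exact: cvgC_mul hl kl].
- by split; [exact: (csubZ bu c bh)|exists (c * l); exact: cvgC_scale hl].
- by split; [exact: (csub_conj bu bh)|exists (l^*); exact: cvgC_conj hl].
apply/uniform_closedC => h Hh; split.
  apply: (iffLR (uniform_closedC _) (csub_closed bu)) => e e0.
  by have [k [bk _] hk] := Hh _ e0; exists k.
(* For a uniform limit h no limit value is at hand, so the Cauchy criterion is checked against an
   approximant k, with four errors of e / 4. *)
apply: cauchy_cvgC => e e0.
have e40 : 0 < e / 4 by rewrite divr_gt0.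
have [k [_ [l kl]] hk] := Hh _ e40.
exists [set x | `|l - k (cst_power x)| < e / 4].
  by move/cvgC_dist: kl => /(_ _ e40).
move=> x y /= lx ly.
have -> : h (cst_power x) - h (cst_power y) =
  ((h (cst_power x) - k (cst_power x)) - (l - k (cst_power x))) +
  ((l - k (cst_power y)) - (h (cst_power y) - k (cst_power y))) by ring.
have -> : e = (e / 4 + e / 4) + (e / 4 + e / 4) by field.
rewrite (le_lt_trans (ler_normD _ _))// ltrD// (le_lt_trans (ler_normB _ _))//.
  by rewrite ltrD.
by rewrite ltrD.
Qed.

(** Compactness is known for row vectors and passes to X through the surjection that a choice of
    basis induces on radial compactifications. *)
Lemma compact_spherical_vect : compact [set: spherical X].
Proof.
pose V : normedModType R := 'rV[R]_(\dim (fullv : {vspace X})).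
pose T : {linear V -> X} := of_coords fullv.
have TZ (r : R) v : T (r *: v) = r *: T v by exact: linearZ.
have T0 v : v != 0 -> T v != 0.
  by apply: contra_neq => Tv; rewrite -[v](@of_coordsK _ _ fullv) -/(T v) Tv linear0.
have cT : continuous T by exact: comb_continuous.
have cV : compact [set: spherical V].
  by apply: compact_spherical; exact: compact_rV_unit_ball.
have := continuous_compact
  (continuous_subspaceT (spherical_map_continuous (psiZ := TZ) (psi_neq0 := T0) cT)) cV.
congr compact; apply/seteqP; split=> // q _.
have [|p pq] := spherical_map_surj TZ T0 _ (linear0 T) q.
  by move=> y; exists (coords fullv y); rewrite /T /= coordsK ?memvf.
by exists p.
Qed.

Let n1 : (0 < 1)%N := ltn0Sn 0.
Let HA := @spherical_algebra_cstar R X 1.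
Let A1 := spherical_algebra1 (@collision_lattice_neq0 R X 1 n1).

(** [k p] sends each element of the algebra to its radial limit at p. *)
Lemma spherical_Omega : exists2 k : spherical X -> Omega X 1, continuous k &
  (forall x, k (inl x) = Omega_in n1 [ffun=> x]) /\ bijective k.
Proof.
have HK p : exists chi : Omega X 1, forall a : A,
    (fun x => val a (cst_power x)) @ radial_filter p --> chi a.
  apply: (@limit_character R W A A1 X (radial_filter p)
    (fun x (a : A) => val a (cst_power x))) => //.
  by move=> a; exact: (spherical_algebra_limit p (eltP a)).
have [k kP] := choice HK.
have kin x : k (inl x) = Omega_in n1 [ffun=> x].
  apply: char_ext => a; apply: cvgC_unique (kP (inl x) a) _.
  have cax : continuous (val a \o cst_power).
    move=> y; apply: continuous_comp; first exact: cst_power_continuous.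
    exact: (bu_continuous (csub_bu HA (eltP a))).
  by apply: cvg_trans (cax x); apply: cvg_app; exact: radial_filter_inl.
have ck : continuous k.
  apply: spectrum_continuous => a p.
  apply/(@cvgC_dist _ _ (nbhs p) (nbhs_filter p)) => e e0.
  have e20 : 0 < e / 2 by rewrite divr_gt0.
  have /cvgC_dist/(_ _ e20)[N Np HN] := kP p a.
  rewrite nbhsE in Np; have [Q [oQ Qp] QN] := Np.
  refine (@filterS _ (nbhs p) (nbhs_filter p) Q _ _
    (open_nbhs_nbhs (conj oQ Qp))) => q Qq /=.
  (* For q in Q, [k q a] is approached by values of [a] at points of Q, all within e / 2 of
     [k p a]. *)
  have /cvgC_dist/(_ _ e20) kq := kP q a.
  have Dq : radial_filter q (inl @^-1` Q) by exists Q => //; exact: open_nbhs_nbhs.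
  have [x [/= kx Qx]] := filter_ex (filterI kq Dq).
  rewrite -(subrK (val a (cst_power x)) (k p a)) -addrA (splitr e).
  rewrite (le_lt_trans (ler_normD _ _))// ltrD//; last by rewrite distrC.
  by apply: HN; exact: QN.
exists k => //; split=> //.
have kinj : injective k.
  move=> p q kpq; have [//|/spherical_separated[g cg gpq]] := eqVneq p q.
  have lin : linear (fun x : W => x 0 : X) by move=> a u v; rewrite !ffunE.
  pose l := GRing.isLinear.Build _ _ _ _ _ lin.
  pose psi : {linear W -> X} := HB.pack (fun x : W => x 0 : X) l.
  have Ag : A (fun x => g (inl (psi x))).
    apply: (@spherical_algebra_linear R X 1 _ X psi g (@collision_coord0 R X 1 0)) => //.
      by move=> x; rewrite mem_coord0.
    exact: coord_power_continuous.
  have kg r : k r (elt Ag) = g r.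
    apply: cvgC_unique (kP r (elt Ag)) _.
    rewrite (_ : (fun x => _) = g \o inl); first exact: radial_cvg.
    by apply/funext => x /=; rewrite /psi /= ffunE.
  by move: gpq; rewrite -kg kpq kg eqxx.
(* The image is compact, hence closed, and contains the dense set of evaluations. *)
have ksurj chi : exists p, k p = chi.
  have cK : closed (k @` setT).
    apply: compact_closed; first exact: spectrum_hausdorff.
    apply: continuous_compact; last exact: compact_spherical_vect.
    exact: continuous_subspaceT.
  have [_ _ _ dK] := @Omega_compactification R X 1 n1.
  apply: contrapT => nchi.
  have [|psi [nk [y _ yE]]] := dK (~` (k @` setT)) _ (closed_openC cK).
    by exists chi => -[p _ kp]; apply: nchi; exists p.
  apply: nk; exists (inl (y 0)) => //.
  by rewrite kin -yE; congr Omega_in; exact/esym/power1_cst.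
have [h hP] := choice ksurj.
by exists h => [p|chi]; [apply: kinj; rewrite hP|rewrite hP].
Qed.

(** The inverse of k is continuous since k maps closed sets, which are compact, to closed sets of a
    Hausdorff space. *)
Lemma Omega1_spherical : exists2 h : Omega X 1 -> spherical X,
  is_homeomorphism h & forall x : X, h (Omega_in n1 [ffun=> x]) = spherical_in x.
Proof.
have [k ck [kin [h kK hK]]] := spherical_Omega.
exists h; last by move=> x; rewrite -kin kK.
split; last by exists k.
apply/continuous_closedP => D cD.
have -> : h @^-1` D = k @` D.
  apply/seteqP; split=> [chi /= Dh|_ [p Dp <-]]; first by exists (h chi).
  by rewrite /preimage /= kK.
apply: compact_closed; first exact: spectrum_hausdorff.
apply: continuous_compact; first exact: continuous_subspaceT.
exact: (subclosed_compact cD compact_spherical_vect).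
Qed.

End SphericalOmega.

(** * Permutations, projections and differences *)

Section LinearMaps.
Context (R : realType) (X : normedVectType R) (n : nat).

(** Covers coordinate permutations and the projections to X^k at once. *)
Definition select k (I : 'I_k -> 'I_n) (x : power X n) : power X k :=
  [ffun a => x (I a)].

Fact select_linear k (I : 'I_k -> 'I_n) : linear (select I).
Proof. by move=> a x y; apply/ffunP => i; rewrite !ffunE. Qed.

HB.instance Definition _ k (I : 'I_k -> 'I_n) :=
  GRing.isLinear.Build R (power X n) (power X k) *:%R (select I) (select_linear I).

Lemma select_continuous k (I : 'I_k -> 'I_n) : continuous (select I).
Proof.
apply: to_power_continuous => i.
rewrite (_ : (fun t => _) = fun x : power X n => x (I i) : X).
  exact: coord_power_continuous.
by apply/funext => x; rewrite ffunE.
Qed.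

Lemma select_coord0 k (I : 'I_k -> 'I_n) j :
  exists2 Y, collision_lattice Y & forall x : power X n, (x \in Y) = (select I x j == 0).
Proof.
exists (Defs.coord0 X (I j)); first exact: collision_coord0.
by move=> x; rewrite mem_coord0 ffunE.
Qed.

(** Injectivity keeps the two selected indices distinct, so the preimage is again a generator. *)
Lemma select_coord_eq k (I : 'I_k -> 'I_n) : injective I -> forall i j, i != j ->
  exists2 Y, collision_lattice Y &
    forall x : power X n, (x \in Y) = (select I x i == select I x j).
Proof.
move=> injI i j ij; exists (coord_eq X (I i) (I j)).
  by apply: collision_coord_eq; rewrite (inj_eq injI).
by move=> x; rewrite mem_coord_eq !ffunE.
Qed.

(** Valued in X^1 rather than X so that [Omega_map] applies. *)
Definition delta (i j : 'I_n) (x : power X n) : power X 1 := [ffun=> x i - x j].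

Fact delta_linear i j : linear (delta i j).
Proof.
by move=> a x y; apply/ffunP => k; rewrite !ffunE scalerBr opprD addrACA.
Qed.

HB.instance Definition _ i j :=
  GRing.isLinear.Build R (power X n) (power X 1) *:%R (delta i j) (delta_linear i j).

Lemma delta_continuous i j : continuous (delta i j).
Proof.
apply: to_power_continuous => k.
rewrite (_ : (fun t => _) = fun x : power X n => x i - x j : X).
  move=> x; apply: (@cvgB R X _ (nbhs x) (nbhs_filter x)
    (fun x : power X n => x i : X) (fun x : power X n => x j : X));
  exact: coord_power_continuous.
by apply/funext => x; rewrite ffunE.
Qed.

End LinearMaps.

(** * The action of the symmetric group on the spectrum *)

Section PermutationAction.
Context (R : realType) (X : normedVectType R) (n : nat) (n0 : (0 < n)%N).

Let perm_index (s : 'S_n) (i : 'I_n) := (s^-1)%g i.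

Let perm_index_inj s : injective (perm_index s).
Proof. exact: perm_inj. Qed.

Definition Omega_perm (chi : Omega X n) (s : 'S_n) : Omega X n :=
  Omega_map n0 n0 (@select_coord0 R X n n (perm_index s))
    (@select_coord_eq R X n n _ (@perm_index_inj s)) (@select_continuous R X n n (perm_index s)) chi.

Lemma Omega_perm1 chi : Omega_perm chi 1%g = chi.
Proof.
apply: char_ext => a; rewrite (Omega_mapE _ _ _ _ _ chi (eltP a)).
  by congr (chi _); apply: val_inj.
move=> x; congr (val a _); apply/ffunP => i.
by rewrite ffunE /perm_index invg1 perm1.
Qed.

(** Inverting indices reverses products, and permutations compose left to right; together this
    yields a right action. The identity is checked on algebra elements, hence at every character. *)
Lemma Omega_permM chi s t :
  Omega_perm chi (s * t)%g = Omega_perm (Omega_perm chi s) t.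
Proof.
apply: char_ext => a; apply: Omega_mapE => x; congr (val a _).
by apply/ffunP => i; rewrite !ffunE /perm_index invMg permM.
Qed.

Definition Omega_action := TotalAction Omega_perm1 Omega_permM.

End PermutationAction.
Theorem theorem1 (R : realType) (X : normedVectType R) (X_eucl : euclidean X) :
  (forall (n : nat) (n0 : (0 < n)%N),
     is_compactification (@Omega_in R X n n0)) /\
  (exists2 h : Omega X 1 -> spherical X,
     is_homeomorphism h &
     forall x : X, h (Omega_in (ltn0Sn 0) [ffun=> x]) = spherical_in x) /\
  (forall (n : nat) (n0 : (0 < n)%N),
     exists act : {action 'S_n &-> Omega X n},
       forall s : 'S_n, continuous (act^~ s) /\
         forall x : power X n,
           act (Omega_in n0 x) s = Omega_in n0 (permute s x)) /\
  (forall (n k : nat) (n0 : (0 < n)%N) (k0 : (0 < k)%N) (I : 'I_k -> 'I_n),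
     {homo I : a b / (a < b)%N} ->
     exists2 p : Omega X n -> Omega X k, continuous p &
       forall x : power X n,
         p (Omega_in n0 x) = Omega_in k0 [ffun a => x (I a)]) /\
  (forall (n : nat) (n0 : (0 < n)%N) (i j : 'I_n), i != j ->
     exists2 d : Omega X n -> Omega X 1, continuous d &
       forall x : power X n,
         d (Omega_in n0 x) = Omega_in (ltn0Sn 0) [ffun=> x i - x j]).
Proof.
split; first by move=> n n0; exact: Omega_compactification.
split; first exact: Omega1_spherical.
split.
  move=> n n0; exists (Omega_action X n0) => s; split.
    exact: Omega_map_continuous.
  by move=> x; exact: Omega_map_in.
split.
  move=> n k n0 k0 I Ilt.
  have injI : injective I.
    move=> a b ab; apply/val_inj; case: (ltngtP a b) => // /Ilt.
      by rewrite ab ltnn.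
    by rewrite ab ltnn.
  exists (Omega_map n0 k0 (@select_coord0 R X n k I) (@select_coord_eq R X n k I injI)
    (@select_continuous R X n k I)); first exact: Omega_map_continuous.
  by move=> x; exact: Omega_map_in.
move=> n n0 i j ij.
(* The preimage of the zero subspace under the difference map is the collision subspace x_i =
   x_j. *)
have d0 k : exists2 Y, collision_lattice Y &
    forall x : power X n, (x \in Y) = (delta i j x k == 0).
  exists (coord_eq X i j); first exact: collision_coord_eq.
  by move=> x; rewrite mem_coord_eq ffunE subr_eq0.
(* Vacuous, as the target has a single coordinate. *)
have d_eq (k l : 'I_1) : k != l -> exists2 Y, collision_lattice Y &
    forall x : power X n, (x \in Y) = (delta i j x k == delta i j x l).
  by rewrite (ord1 k) (ord1 l) eqxx.
exists (Omega_map n0 (ltn0Sn 0) d0 d_eq (@delta_continuous R X n i j)).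
  exact: Omega_map_continuous.
by move=> x; exact: Omega_map_in.
Qed.
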